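(* Let $G$ be a group. For $j=1,\ldots,n$ let $\sigma_j$ be a splitting of $G$ over $H_j$, and assume $\{\sigma_1,\ldots,\sigma_n\}$ satisfies sandwiching. Let $X_j$ be an $H_j$-almost invariant set arising from $\sigma_j$. If $i(\sigma_j,\sigma_k)=0$ for all $j$ and $k$, then the splittings $\{\sigma_1,\ldots,\sigma_n\}$ are compatible.
   Context: For $X\subset G$, $X^*=G\setminus X$, $\Sigma(X)=\{gX,gX^*\mid g\in G\}$, $\mathrm{Stab}(X)=\{g: gX=X\}$. A subset of $G$ is $H$-finite if it is contained in finitely many right cosets $Hg_i$. The corners of a pair $(A,B)$ are $A\cap B$, $A\cap B^*$, $A^*\cap B$, $A^*\cap B^*$. A $G$-tree is a simplicial tree with a simplicial $G$-action that inverts no edge. A splitting of $G$ is a $G$-tree $T$ with no global fixed point such that $G\backslash T$ has exactly one edge; it is over $H$ if $H$ is an edge stabilizer. Two splittings are isomorphic if their trees are $G$-equivariantly isomorphic. An $H$-almost invariant set arising from the splitting is a set $X=\{g\in G : e \text{ points away from } gv\}$, where $v$ is a vertex of $T$, $e$ is a directed edge of $T$, and $H=\mathrm{Stab}(e)=\mathrm{Stab}(X)$; ''$e$ points away from $gv$'' means that $gv$ lies in the component of $T$ minus the interior of $e$ containing the initial vertex of $e$. Let $\Sigma=\bigcup_j\Sigma(X_j)$. For $A,B\in\Sigma$, a corner of $(A,B)$ is small if it is $\mathrm{Stab}(A)$-finite (equivalently, here, $\mathrm{Stab}(B)$-finite); $A$ crosses $B$ if no corner is small. $A\leq B$ means that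 $A\cap B^*$ is empty or is the only small corner of $(A,B)$; this is a partial order if the $\sigma_j$ are pairwise non-isomorphic. The intersection number $i(\sigma_j,\sigma_k)$ is the number of double cosets $H_kgH_j$ such that $gX_j$ crosses $X_k$. Sandwiching: $X_j$ is sandwiched by $X_k$ if either there exist $A,B\in\Sigma(X_k)$ with $A\leq X_j\leq B$, or $X_j$ crosses every element of $\Sigma(X_k)$. $\{\sigma_j\}$ satisfies sandwiching if for all $j,k$, $X_j$ is sandwiched by $X_k$ (the choice of sets $X_j$ arising from $\sigma_j$ does not matter; isomorphic splittings may be represented by the same set, so that $\leq$ is a partial order on $\Sigma$). A compatibility tree for $\{\sigma_j\}$ is a $G$-tree with exactly one edge orbit for each $j$ (a bijection between indices and edge orbits), such that for each $j$ collapsing all edges except those in the orbit of $j$ yields a tree for $\sigma_j$. The collection is compatible if it has a compatibility tree. *)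

(* Defs.v *)
From HB Require Import structures.
From mathcomp Require Import all_boot finmap all_classical.

Set Implicit Arguments.
Unset Strict Implicit.
Unset Printing Implicit Defensive.

Local Open Scope group_scope.
Local Open Scope classical_set_scope.

(* A directed edge is an ordered pair (a, b) with adj a b, and an edge is such
   a pair up to swapping.  Loops are not excluded here (is_tree does that), so
   that collapse below is defined for any graph and any edge orbit. *)
Record ggraph (G : groupType) := GGraph {
  vertex :> eqType;
  adj : rel vertex;
  act : G -> vertex -> vertex;
  adjC : symmetric adj;
  act1 : forall v, act 1 v = v;
  actM : forall g h v, act (g * h) v = act g (act h v);
  adj_act : forall g v w, adj (act g v) (act g w) = adj v w
}.

Definition joined (V : eqType) (e : rel V) (x y : V) : Prop :=
  exists2 p, path e x p & y = last x p.

Definition is_tree (V : eqType) (e : rel V) : Prop :=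
  [/\ inhabited V, irreflexive e, forall x y, joined e x y &
      forall c : seq V, uniq c -> cycle e c -> size c <= 2].

Section GGraphs.
Context {G : groupType}.
Implicit Types (T : ggraph G) (g : G).

Definition inverts_no_edge T : Prop :=
  forall g (a b : T), adj a b -> ~ (act g a = b /\ act g b = a).

Definition is_gtree T : Prop := is_tree (@adj G T) /\ inverts_no_edge T.

(* The orbit of the undirected edge {a, b}, as a symmetric set of pairs. *)
Definition edge_orbit T (a b : T) : set (T * T) :=
  [set p | exists g, p = (act g a, act g b) \/ p = (act g b, act g a)].

Definition edge_orbits T : set (set (T * T)) :=
  [set O | exists a b : T, adj a b /\ O = edge_orbit a b].
Arguments edge_orbits T : clear implicits.

(* As no edge is inverted, this is also the stabilizer of the undirected
   edge. *)
Definition edge_stab T (a b : T) : set G :=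
  [set g | act g a = a /\ act g b = b].

(* As no edge is inverted, a point of the geometric realization of T fixed by
   G is a vertex or lies on an edge with fixed end vertices. *)
Definition has_fixed_point T : Prop := exists v : T, forall g, act g v = v.

Definition is_splitting T : Prop :=
  [/\ is_gtree T, ~ has_fixed_point T & exists O, edge_orbits T = [set O]].

Definition is_splitting_over T (H : set G) : Prop :=
  is_splitting T /\ exists a b : T, adj a b /\ H = edge_stab a b.

Definition gg_iso (T T' : ggraph G) : Prop :=
  exists f : T -> T', [/\ bijective f,
    forall v w, adj (f v) (f w) = adj v w &
    forall g v, f (act g v) = act g (f v)].

Definition minus_edge T (a b : T) : rel T :=
  [rel x y | [&& adj x y, (x, y) != (a, b) & (x, y) != (b, a)]].

(* The directed edge (a, b), with initial vertex a, points away from x. *)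
Definition points_away T (a b x : T) : Prop := joined (minus_edge a b) a x.

(* Collapse of all the edges except those in the orbit O. *)
Section Collapse.
Variables (T : ggraph G) (O : set (T * T)).

Definition kept : rel T := [rel x y | adj x y && `[< edge_orbit x y = O >]].

Definition lost : rel T := [rel x y | adj x y && ~~ kept x y].

Definition lost_class (v : T) : set T := [set w | joined lost v w].

Definition collapse_vertex : eqType :=
  {C : set T | `[< exists v, C = lost_class v >]}.

Definition collapse_adj : rel collapse_vertex := fun C D =>
  `[< exists v w : T, [/\ val C v, val D w & kept v w] >].

Lemma edge_orbit_act g (v w : T) :
  edge_orbit (act g v) (act g w) = edge_orbit v w.
Proof.
apply/seteqP; split=> p [h hp].
  by exists (h * g); rewrite !actM.
by exists (h * g^-1); rewrite -!actM -mulgA mulVg mulg1.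
Qed.

Lemma edge_orbitC (v w : T) : edge_orbit v w = edge_orbit w v.
Proof. by apply/seteqP; split=> p [h [] hp]; exists h; [right|left|right|left]. Qed.

Lemma keptC : symmetric kept.
Proof. by move=> v w; rewrite /kept /= adjC edge_orbitC. Qed.

Lemma kept_act g v w : kept (act g v) (act g w) = kept v w.
Proof. by rewrite /kept /= adj_act edge_orbit_act. Qed.

Lemma lost_act g v w : lost (act g v) (act g w) = lost v w.
Proof. by rewrite /lost /= kept_act adj_act. Qed.

Lemma actK g : cancel (@act G T g) (act g^-1).
Proof. by move=> v; rewrite -actM mulVg act1. Qed.

Lemma actVK g : cancel (@act G T g^-1) (act g).
Proof. by move=> v; rewrite -actM mulgV act1. Qed.

Lemma joined_lost_act g v w : joined lost v w -> joined lost (act g v) (act g w).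
Proof.
case=> p vp ->; exists (map (act g) p); last by rewrite last_map.
by rewrite path_map (eq_path (e' := lost)) // => x y; exact: lost_act.
Qed.

Lemma act_lost_class g v : act g @` lost_class v = lost_class (act g v).
Proof.
apply/seteqP; split=> [_ [w vw <-]|w vw]; first exact: joined_lost_act.
exists (act g^-1 w); last exact: actVK.
by rewrite /lost_class /= -[v](actK g); exact: joined_lost_act.
Qed.

Lemma collapse_act_subproof g (C : collapse_vertex) :
  `[< exists v, act g @` val C = lost_class v >].
Proof.
apply/asboolP; case: C => C /= /asboolP[v ->].
by exists (act g v); exact: act_lost_class.
Qed.

Definition collapse_act g (C : collapse_vertex) : collapse_vertex :=
  Sub (act g @` val C) (collapse_act_subproof g C).

Lemma collapse_adjC : symmetric collapse_adj.
Proof.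
by move=> C D; apply/asboolP/asboolP => -[v [w [Cv Dw vw]]];
  exists w, v; rewrite keptC.
Qed.

Lemma collapse_act1 C : collapse_act 1 C = C.
Proof.
apply: val_inj; rewrite /= -[RHS]image_id.
by apply: eq_imagel => v _; rewrite act1.
Qed.

Lemma collapse_actM g h C :
  collapse_act (g * h) C = collapse_act g (collapse_act h C).
Proof.
apply: val_inj; rewrite /= image_comp.
by apply: eq_imagel => v _; rewrite actM.
Qed.

Lemma collapse_adj_act g C D :
  collapse_adj (collapse_act g C) (collapse_act g D) = collapse_adj C D.
Proof.
apply/asboolP/asboolP => -[v [w [Cv Dw vw]]].
  case: Cv Dw vw => v' Cv' <- [w' Dw' <-]; rewrite kept_act => vw'.
  by exists v', w'.
by exists (act g v), (act g w); split; [exists v|exists w|rewrite kept_act].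
Qed.

Definition collapse : ggraph G :=
  GGraph collapse_adjC collapse_act1 collapse_actM collapse_adj_act.

End Collapse.

Definition is_compatibility_tree n (sigma : 'I_n -> ggraph G) T : Prop :=
  is_gtree T /\ exists O : 'I_n -> set (T * T),
    set_bij setT (edge_orbits T) O /\
    forall j, gg_iso (collapse (O j)) (sigma j).

Definition compatible n (sigma : 'I_n -> ggraph G) : Prop :=
  exists T, is_compatibility_tree sigma T.

End GGraphs.

Section AlmostInvariantSets.
Context {G : groupType}.
Implicit Types (A B C X Y H K : set G) (g : G) (T : ggraph G).

Definition translate g X : set G := [set g * x | x in X].

Definition stab X : set G := [set g | translate g X = X].

Definition Sigma X : set (set G) :=
  [set A | exists g, A = translate g X \/ A = translate g (~` X)].

Definition Hfinite H A : Prop :=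
  exists2 F : set G, finite_set F & A `<=` [set h * g | h in H & g in F].

Definition arises_from T H X : Prop :=
  exists v a b : T, [/\ adj a b, H = edge_stab a b, H = stab X &
    X = [set g | points_away a b (act g v)]].

(* Whether a corner C of (A, B) is small. *)
Definition small A C : Prop := Hfinite (stab A) C.

Definition crosses A B : Prop :=
  [/\ ~ small A (A `&` B), ~ small A (A `&` ~` B),
      ~ small A (~` A `&` B) & ~ small A (~` A `&` ~` B)].

Definition ai_le A B : Prop :=
  A `&` ~` B = set0 \/
  [/\ small A (A `&` ~` B), ~ small A (A `&` B),
      ~ small A (~` A `&` B) & ~ small A (~` A `&` ~` B)].

Definition double_coset K g H : set G := [set k * g * h | k in K & h in H].

Definition crossing_cosets H X K Y : set (set G) :=
  [set D | exists g, D = double_coset K g H /\ crosses (translate g X) Y].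

(* i(sigma_j, sigma_k) for H = H_j, X = X_j, K = H_k, Y = X_k; None stands for
   an infinite number. *)
Definition intersection_number H X K Y : option nat :=
  if `[< finite_set (crossing_cosets H X K Y) >]
  then Some #|` fset_set (crossing_cosets H X K Y)|%fset else None.

Definition sandwiched X Y : Prop :=
  (exists A B, [/\ Sigma Y A, Sigma Y B, ai_le A X & ai_le X B]) \/
  (forall B, Sigma Y B -> crosses X B).

(* The condition does not depend on the sets chosen to represent the
   splittings, so it is stated for some choice.  Isomorphic splittings are
   represented by the same set, which makes ai_le a partial order; the edge
   stabilizers K are left free as isomorphic splittings may be given over
   different conjugates. *)
Definition satisfies_sandwiching n (sigma : 'I_n -> ggraph G) : Prop :=
  exists Y : 'I_n -> set G,
    [/\ forall j, exists K, arises_from (sigma j) K (Y j),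
        forall j k, gg_iso (sigma j) (sigma k) -> Y j = Y k &
        forall j k, sandwiched (Y j) (Y k)].

End AlmostInvariantSets.

(* Main.v *)
Require Import Defs.
From mathcomp Require Import all_boot finmap all_classical.

(** The edges of the trees of the splittings, ordered by almost inclusion of
    their almost invariant sets (and by inclusion inside one tree), form a
    nested pocset since no two translates cross; sandwiching makes its
    intervals finite, so that it is the set of directed edges of a tree, a
    vertex of which is the set of all half-spaces containing it.  By sandwiching
    again, this vertex determines a vertex of each of the original trees, which
    identifies the collapses with these trees.  Almost inclusion is antisymmetric
    between different trees because equivalent almost invariant sets come from
    isomorphic splittings: an equivalence preserves the order of the translates
    of an edge, once the edge has been chosen next to the centre of a reflection
    when G reverses the chain of the edges equivalent to it. *)

Set Implicit Arguments.
Unset Strict Implicit.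
Unset Printing Implicit Defensive.

(** Almost inclusion cannot order the edges of a single tree: for the integers acting on a line by
    translations, all translates of an edge have equivalent sets. This is why inclusion of
    half-trees is used there, and why the two orders must be shown to fit together, the delicate
    point being the transitivity of a chain that leaves a tree and returns to it. [small] refers to
    the stabilizer of the first set of a pair and G need not be finitely generated, so that
    contraposition and transitivity of almost inclusion already need an argument. It rests on one
    device: if a coset of a subgroup avoids A, then a subset of A that is finite for this subgroup
    is also finite for the stabilizer of A. Equivalent sets leave one ambiguity in the order of the
    translates of an edge, namely between g e and the reverse of e when they belong to one chain of
    equivalent edges. The infinite dihedral group acting on a line, with reflections in vertices,
    shows that this occurs. *)

Section Joined.
Variables (V : eqType) (e : rel V).

Lemma joinedxx x : joined e x x.
Proof. by exists [::]. Qed.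

Lemma joined1 x y : e x y -> joined e x y.
Proof. by move=> xy; exists [:: y] => //=; rewrite xy. Qed.

Lemma joined_trans y x z : joined e x y -> joined e y z -> joined e x z.
Proof.
case=> p xp -> [q yq ->]; exists (p ++ q); first by rewrite cat_path xp.
by rewrite last_cat.
Qed.

Lemma joined_sym : symmetric e -> forall x y, joined e x y -> joined e y x.
Proof.
move=> eC x y [p + ->]; elim: p x => [|z p IHp] x /=; first by exists [::].
by case/andP=> xz /IHp zx; apply: (joined_trans zx); apply: joined1; rewrite eC.
Qed.

Lemma joined_ind (P : V -> Prop) x :
    P x -> (forall y z, P y -> e y z -> P z) ->
  forall y, joined e x y -> P y.
Proof.
move=> Px PS y [p + ->]; elim: p x Px => [//|z p IHp] x Px /= /andP[xz zp].
exact: IHp (PS _ _ Px xz) zp.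
Qed.

Lemma path_crossing (P : V -> Prop) x p :
  P x -> ~ P (last x p) -> path e x p ->
  exists p1 y z p2, [/\ x :: p = p1 ++ y :: z :: p2, P y, ~ P z & e y z].
Proof.
elim: p x => [|z p IHp] x //= Px nPl /andP[xz zp].
have [Pz|nPz] := pselect (P z); last by exists [::], x, z, p.
by have [p1 [y [w [p2 [-> ? ? ?]]]]] := IHp z Pz nPl zp; exists (x :: p1), y, w, p2.
Qed.

End Joined.

(** * Half-trees of a tree, ordered by inclusion *)

Section Trees.
Context {G : groupType} (T : ggraph G).
Local Open Scope group_scope.
Local Open Scope classical_set_scope.

Definition dedge := {p : T * T | adj p.1 p.2}.

Definition src (e : dedge) : T := (val e).1.
Definition tgt (e : dedge) : T := (val e).2.

Definition mk_dedge (x y : T) (xy : adj x y) : dedge := exist _ (x, y) xy.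

Lemma dedgeP (e : dedge) : adj (src e) (tgt e).
Proof. by case: e. Qed.

Lemma rev_subproof (e : dedge) : adj (tgt e) (src e).
Proof. by rewrite adjC dedgeP. Qed.

Definition rev (e : dedge) : dedge := mk_dedge (rev_subproof e).

Lemma eact_subproof g (e : dedge) : adj (act g (src e)) (act g (tgt e)).
Proof. by rewrite adj_act dedgeP. Qed.

Definition eact g (e : dedge) : dedge := mk_dedge (eact_subproof g e).

Definition side (e : dedge) : set T := points_away (src e) (tgt e).

Definition ele (e f : dedge) : Prop := side e `<=` side f.

Lemma dedge_eq (e f : dedge) : src e = src f -> tgt e = tgt f -> e = f.
Proof.
by case: e f => -[a b] ab [[c d] cd]; rewrite /src /tgt /= => ? ?;
  apply: val_inj => /=; congr (_, _).
Qed.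

Lemma revK : involutive rev. Proof. by move=> e; apply: dedge_eq. Qed.
Lemma src_eact g e : src (eact g e) = act g (src e). Proof. by []. Qed.
Lemma tgt_eact g e : tgt (eact g e) = act g (tgt e). Proof. by []. Qed.
Lemma eact1 e : eact 1 e = e.
Proof. by apply: dedge_eq; rewrite ?src_eact ?tgt_eact act1. Qed.
Lemma eactM g h e : eact (g * h) e = eact g (eact h e).
Proof. by apply: dedge_eq; rewrite !(src_eact, tgt_eact) actM. Qed.
Lemma eactK g : cancel (eact g) (eact g^-1).
Proof. by move=> e; rewrite -eactM mulVg eact1. Qed.
Lemma eactVK g : cancel (eact g^-1) (eact g).
Proof. by move=> e; rewrite -eactM mulgV eact1. Qed.
Lemma rev_eact g e : rev (eact g e) = eact g (rev e).
Proof. by apply: dedge_eq. Qed.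

Lemma minus_edge_sym (a b : T) : symmetric (minus_edge a b).
Proof.
move=> x y; rewrite /minus_edge /= adjC !xpair_eqE; case: (adj y x) => //=.
by rewrite andbC [in RHS]andbC [(y == a) && _]andbC [(y == b) && _]andbC andbC.
Qed.

Lemma minus_edgeC (a b x y : T) : minus_edge a b x y = minus_edge b a x y.
Proof. by rewrite /minus_edge /= [X in _ && X]andbC. Qed.

Lemma minus_edge_act g (a b x y : T) :
  minus_edge (act g a) (act g b) (act g x) (act g y) = minus_edge a b x y.
Proof.
have inj u v : (act g u == act g v) = (u == v).
  by apply/eqP/eqP => [E|-> //]; rewrite -[u](actK g) E actK.
by rewrite /minus_edge /= adj_act !xpair_eqE !inj.
Qed.

Lemma side_act g e x : side (eact g e) (act g x) <-> side e x.
Proof.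
have imp h f y : side f y -> side (eact h f) (act h y).
  case=> p xp ->; exists (map (act h) p); last exact/esym/last_map.
  rewrite -[src (eact h f)]/(act h (src f)) path_map.
  by apply: sub_path xp => u v; rewrite /= -[tgt (eact h f)]/(act h (tgt f))
    minus_edge_act.
split=> [|/imp //]; by move=> /(imp g^-1); rewrite eactK actK.
Qed.

Lemma ele_refl e : ele e e. Proof. by []. Qed.
Lemma ele_trans f e h : ele e f -> ele f h -> ele e h.
Proof. exact: subset_trans. Qed.
Lemma ele_act g e f : ele (eact g e) (eact g f) <-> ele e f.
Proof.
have imp h e' f' : ele e' f' -> ele (eact h e') (eact h f').
  by move=> ef x; rewrite -[x](actVK h) !side_act; apply: ef.
split=> [|/imp //]; by move=> /(imp g^-1); rewrite !eactK.
Qed.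

Lemma src_side e : side e (src e). Proof. exact: joinedxx. Qed.

Hypothesis treeT : is_tree (@adj G T).

Let conn x y : joined (@adj G T) x y. Proof. by case: treeT. Qed.

Lemma adj_irr (x : T) : adj x x = false. Proof. by case: treeT => _ /(_ x). Qed.

Lemma src_neq_tgt e : src e != tgt e.
Proof. by apply/eqP => E; have := dedgeP e; rewrite E adj_irr. Qed.

(** Once shortened to a simple path, a detour around [e] closes up with [e] to a cycle; acyclicity
    leaves only [e] itself, which has been removed. *)
Lemma tgt_nside e : ~ side e (tgt e).
Proof.
case=> p; set b := tgt e; set a := src e => ap.
have ba : b != a by rewrite eq_sym src_neq_tgt.
case: (shortenP ap) => {ap}p ap Up _ bE.
have acyc : size (a :: p) <= 2.
  case: treeT => _ _ _; apply=> //=; rewrite rcons_path.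
  rewrite -bE (rev_subproof e) andbT.
  by apply: sub_path ap => u v; rewrite /= => /and3P[].
case: p bE ap acyc {Up} => [|c [|d p]] //= bE; first by rewrite bE eqxx in ba.
by case/andP=> /and3P[_ + _] _; rewrite -bE eqxx.
Qed.

Lemma side_rev e x : side (rev e) x <-> ~ side e x.
Proof.
have cov : side e x \/ side (rev e) x.
  apply: (@joined_ind _ (@adj G T) (fun x => side e x \/ side (rev e) x) (src e)).
  - by left; exact: src_side.
  - move=> y z H yz.
    have [E|/eqP nE] := eqVneq (y, z) (src e, tgt e).
      by right; case: E => _ ->; exact: (src_side (rev e)).
    have [E|/eqP nE'] := eqVneq (y, z) (tgt e, src e).
      by left; case: E => _ ->; exact: src_side.
    have st : minus_edge (src e) (tgt e) y z.
      by apply/and3P; split=> //; apply/eqP.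
    case: H => H; [left|right]; apply: (joined_trans H); apply: joined1 => //.
    by rewrite /= minus_edgeC.
  - exact: conn.
split=> [h1 h2|h]; last by case: cov.
apply: (@tgt_nside e); apply: (joined_trans h2).
apply: (joined_sym (@minus_edge_sym _ _)).
case: h1 => p xp ->; exists p => //.
by apply: sub_path xp => u v; rewrite /= minus_edgeC.
Qed.

Lemma side_revE e : side (rev e) = ~` side e.
Proof. by apply/seteqP; split=> x /side_rev. Qed.

Lemma side_crossing e (x y : T) : adj x y -> side e x -> ~ side e y ->
  x = src e /\ y = tgt e.
Proof.
move=> xy ex ney; have [[-> ->] //|/eqP nE] := eqVneq (x, y) (src e, tgt e).
have [[? ?]|/eqP nE'] := eqVneq (x, y) (tgt e, src e).
  by case: ney; subst y; exact: src_side.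
case: ney; apply: (joined_trans ex); apply: joined1.
by apply/and3P; split=> //; apply/eqP.
Qed.

Lemma ele_rev e f : ele (rev e) (rev f) <-> ele f e.
Proof. by rewrite /ele !side_revE setCS. Qed.

Lemma ele_revl e f : ele (rev e) f <-> ele (rev f) e.
Proof. by rewrite -{1}[f]revK ele_rev. Qed.

Lemma ele_revr e f : ele e (rev f) <-> ele f (rev e).
Proof. by rewrite -{1}[e]revK ele_rev. Qed.

Lemma ele_anti e f : ele e f -> ele f e -> e = f.
Proof.
move=> ef fe; have [] := @side_crossing f (src e) (tgt e) (dedgeP e).
- exact/ef/src_side.
- by move=> /fe; exact: tgt_nside.
- exact: dedge_eq.
Qed.

(* If [e] misses the edge [f], the component of [tgt e] lies on one side of f. *)
Lemma ele_of_side e f : side e (src f) -> side e (tgt f) ->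
  ele (rev e) f \/ ele (rev e) (rev f).
Proof.
move=> es et.
have H x : side (rev e) x -> joined (minus_edge (src f) (tgt f)) (tgt e) x.
  case=> p + ->; elim/last_ind: p => [|p y IHp] /=; first by exists [::].
  rewrite rcons_path last_rcons => /andP[/[dup] tp /IHp {}IHp yz].
  apply: (joined_trans IHp); apply: joined1.
  have nz : side (rev e) (last (src (rev e)) p) by exists p.
  have nz' : side (rev e) y.
    by exists (rcons p y); rewrite ?last_rcons // rcons_path tp.
  case/and3P: yz => yz _ _; apply/and3P; split=> //.
    by apply/eqP => -[E _]; move/side_rev: nz; apply; rewrite /= E.
  by apply/eqP => -[_ E]; move/side_rev: nz'; apply; rewrite E.
have [ft|nft] := pselect (side f (tgt e)); [left|right] => x /H tx.
  exact: joined_trans ft tx.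
apply/side_rev => fx; apply: nft; apply: (joined_trans fx).
exact: joined_sym (@minus_edge_sym _ _) _ _ tx.
Qed.

(** Unless [f] is [e] up to reversal, both ends of [f] lie on the same side of [e], and
    [ele_of_side] applies to [e] or to [rev e]. *)
Lemma nested e f :
  [\/ ele e f, ele f e, ele e (rev f) | ele (rev f) e].
Proof.
have [s|s] := pselect (side e (src f)); have [t|t] := pselect (side e (tgt f)).
- case: (ele_of_side s t) => [/ele_revl|/ele_rev] h; first exact: Or44.
  exact: Or42.
- have [? ?] := side_crossing (dedgeP f) s t.
  by constructor 1; suff -> : e = f by []; exact: dedge_eq.
- have [] // := @side_crossing e (tgt f) (src f); first exact: rev_subproof.
  move=> ? ?; constructor 3; suff -> : e = rev f by [].
  exact: dedge_eq.
- have {}s : side (rev e) (src f) by apply/side_rev.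
  have {}t : side (rev e) (tgt f) by apply/side_rev.
  by case: (ele_of_side s t); rewrite revK => h; [exact: Or41|exact: Or43].
Qed.

Definition path_pairs (x : T) (p : seq T) : seq (T * T) :=
  zip (x :: p) p.

Lemma sep_path e x p : path (@adj G T) x p -> side e x -> ~ side e (last x p) ->
  (src e, tgt e) \in path_pairs x p.
Proof.
elim: p x => [|y p IHp] x //= /andP[xy yp] ex nel; rewrite in_cons.
have [ey|ney] := pselect (side e y).
  by rewrite -/(path_pairs _ _) IHp // orbT.
by have [-> ->] := side_crossing xy ex ney; rewrite eqxx.
Qed.

Lemma separating_finite x y : exists s : seq dedge,
  forall e, side e x -> ~ side e y -> e \in s.
Proof.
have [p xp ->] := conn x y.
exists (pmap insub (path_pairs x p)) => e ex ney.
rewrite mem_pmap_sub /=; move: (sep_path xp ex ney).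
by rewrite /src /tgt -surjective_pairing.
Qed.

Lemma interval_finite e f : exists s : seq dedge,
  forall z, ele e z -> ele z f -> z \in s.
Proof.
have [s Hs] := separating_finite (src e) (tgt f).
exists s => z ez zf; apply: Hs; first exact/ez/src_side.
by move=> /zf; exact: tgt_nside.
Qed.

(** The half-trees around a vertex are expressed by the order and [rev] alone. Hence an order
    isomorphism of edges acts on vertices, and the same formula defines the vertices of an abstract
    pocset in [star_set]. *)
Lemma src_sideP e f :
  side f (src e) <-> ele e f \/ (ele (rev e) f /\ f <> rev e).
Proof.
split=> [fe|[ef|[ef nE]]]; last first.
- apply: contrapT => nfe; apply: nE.
  have [] // := @side_crossing f (tgt e) (src e); first exact: rev_subproof.
    exact/ef/src_side.
  by move=> ? ?; apply: dedge_eq.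
- exact/ef/src_side.
have [->|nE] := pselect (f = e); first by left.
have ft : side f (tgt e).
  apply: contrapT => nft; have [? ?] := side_crossing (dedgeP e) fe nft.
  by apply: nE; exact: dedge_eq.
case: (ele_of_side fe ft) => [/ele_revl h|/ele_rev]; last by left.
right; split=> // E; move: fe; rewrite E => /side_rev; apply.
exact: src_side.
Qed.

(** The first edge of a simple path from [x] to [y] separates them: to cross it back, the path would
    have to return to [x]. *)
Lemma sides_separate x y : (forall e, side e x <-> side e y) -> x = y.
Proof.
move=> H; have [//|nxy] := eqVneq x y.
have [p xp yE] := conn x y.
case: (shortenP xp) yE => {xp}p xp Up _ yE.
case: p xp Up yE => [|z p] /=; first by move=> _ _ E; rewrite E eqxx in nxy.
case/andP=> xz zp /and3P[xNzp zNp Up] yE.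
set e : dedge := mk_dedge xz.
have ey : side e y by apply/H; exact: src_side.
have [||p1 [u [w [p2 [E Pu nPw uw]]]]] :=
  @path_crossing _ _ (fun v => ~ side e v) _ _ _ _ zp.
- exact: (@tgt_nside e).
- by rewrite -yE.
have [|||wx _] := @side_crossing e w u; first by rewrite adjC.
- exact: contrapT nPw.
- exact: Pu.
by move: xNzp; rewrite -[x]/(src e) -wx E mem_cat !in_cons eqxx !orbT.
Qed.

End Trees.

(** * Sets covered by finitely many cosets *)

Section Hfinite.
Context {G : groupType}.
Implicit Types (H A B : set G).
Local Open Scope group_scope.
Local Open Scope classical_set_scope.

Lemma sub_Hfinite H A B : A `<=` B -> Hfinite H B -> Hfinite H A.
Proof. by move=> AB [F Ff BF]; exists F => //; apply: subset_trans BF. Qed.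

Lemma HfiniteU H A B : Hfinite H A -> Hfinite H B -> Hfinite H (A `|` B).
Proof.
case=> F Ff AF [F' Ff' BF']; exists (F `|` F'); first by rewrite finite_setU.
by move=> x [/AF|/BF'] [h Hh [g Fg <-]]; exists h => //; exists g => //;
  [left|right].
Qed.

Lemma Hfinite0 H : Hfinite H set0.
Proof. by exists set0. Qed.

Lemma Hfinite_mulr H A k : Hfinite H A -> Hfinite H [set x | A (x * k)].
Proof.
case=> F Ff AF; exists [set g * k^-1 | g in F]; first exact: finite_image.
move=> x /AF [h Hh [g Fg hg]]; exists h => //; exists (g * k^-1); first by exists g.
by rewrite mulgA hg mulgK.
Qed.

Lemma Hfinite_by (U : eqType) (f : G -> U) (s : seq U) H A :
    (forall g, A g -> f g \in s) ->
    (forall g g', A g -> A g' -> f g = f g' -> H (g * g'^-1)) ->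
  Hfinite H A.
Proof.
move=> fs fH; pose c z := xget 1 [set g | A g /\ f g = z].
exists [set c z | z in [set` s]]; first exact/finite_image/finite_seq.
move=> g Ag; have [Ac fc] : A (c (f g)) /\ f (c (f g)) = f g.
  by rewrite /c; case: xgetP => [_ _ [? ?] //|/(_ g)]; case.
exists (g * (c (f g))^-1); first by apply: fH.
by exists (c (f g)); [exists (f g) => //; exact: fs|rewrite mulgVK].
Qed.

End Hfinite.

(** * The tree of a splitting and the sets given by its edges *)

Section Splitting.
Context {G : groupType} (T : ggraph G).
Local Open Scope group_scope.
Local Open Scope classical_set_scope.
Hypothesis splitT : is_splitting T.

Lemma splitting_tree : is_tree (@adj G T).
Proof. by case: splitT => -[]. Qed.
Let treeT := splitting_tree.

Lemma eact_neq_rev g (e : dedge T) : eact g e <> rev e.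
Proof.
case: splitT => -[_ inv] _ _ E; apply: (inv g _ _ (dedgeP e)).
by split; [rewrite -src_eact E|rewrite -tgt_eact E].
Qed.

Lemma dedge_orbit (e f : dedge T) : exists g, f = eact g e \/ f = eact g (rev e).
Proof.
case: splitT => _ _ [O EO].
have orb (z : dedge T) : edge_orbit (src z) (tgt z) = O.
  have : @edge_orbits G T (edge_orbit (src z) (tgt z)).
    by exists (src z), (tgt z); split=> //; exact: dedgeP.
  by rewrite EO.
have : edge_orbit (src e) (tgt e) (src f, tgt f).
  by rewrite orb -(orb f); exists 1; left; rewrite !act1.
by case=> g [] [? ?]; exists g; [left|right]; apply: dedge_eq.
Qed.

Lemma dedge_inhabited : inhabited (dedge T).
Proof.
case: splitT => _ _ [O EO]; have : @edge_orbits G T O by rewrite EO.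
by case=> a [b [ab _]]; constructor; exact: mk_dedge ab.
Qed.

Lemma vertex_incident (x : T) : exists e : dedge T, src e = x.
Proof.
case: dedge_inhabited => e.
have [_ _ /(_ x (src e)) [p xp xE] _] := treeT.
case: p xp xE => [|y p] /=; first by move=> _ <-; exists e.
by case/andP=> xy _ _; exists (mk_dedge xy).
Qed.

Lemma adj_closed (P : T -> Prop) x : P x ->
  (forall y z, P y -> adj y z -> P z) -> forall y, P y.
Proof. by move=> Px PS y; apply: (joined_ind Px PS); case: treeT. Qed.

(* If the end [src e] were a leaf then, all edges being equivalent, T would be
   a star or a single edge, with a fixed point in either case. *)
Lemma no_leaf (e : dedge T) : exists f, ele f e /\ f <> e.
Proof.
set a := src e; set b := tgt e; have ab : adj a b := dedgeP e.
have [[c [ac cb]]|leaf_a] := pselect (exists c, adj a c /\ c <> b).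
  have ca : adj c a by rewrite adjC.
  exists (mk_dedge ca); set f := mk_dedge ca; split; last first.
    by move=> fe; have := src_neq_tgt treeT e; rewrite -{2}fe eqxx.
  have ec : side e c.
    by apply: contrapT => nec; case: (side_crossing ac (src_side e) nec).
  have [|h|/(ele_rev treeT) //] := @ele_of_side _ _ treeT e f ec;
    first exact: src_side.
  have [] // := @side_crossing _ _ f b a; first by rewrite adjC.
  - exact/h/(src_side (rev e)).
  - exact: (@tgt_nside _ _ treeT f).
  - by move=> bc _; case: cb; rewrite bc.
have nbr_a c : adj a c -> c = b.
  by move=> ac; apply: contrapT => cb; apply: leaf_a; exists c.
have leaf_ga g c : adj (act g a) c -> c = act g b.
  by rewrite -{1}[c](actVK g) adj_act => /nbr_a <-; rewrite actVK.
suff fixb : has_fixed_point T by case: splitT.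
exists b => g.
have [[c [bc ca]]|leaf_b] := pselect (exists c, adj b c /\ c <> a).
  have nleaf h : b <> act h a.
    move=> E; have ba : adj b a by rewrite adjC.
    by apply: ca; move: bc ba; rewrite {1 2}E => /leaf_ga -> /leaf_ga ->.
  have bnb z : adj b z -> exists2 h, z = act h a & b = act h b.
    move=> bz; have [h []] := dedge_orbit e (mk_dedge bz).
      by move=> E; case: (nleaf h); rewrite -src_eact -E.
    move=> E; exists h; last by rewrite -[LHS]/(src (mk_dedge bz)) E.
    by rewrite -[LHS]/(tgt (mk_dedge bz)) E.
  have [//|gb] : act g b = b \/ adj b (act g b).
    apply: (adj_closed (P := fun z => z = b \/ adj b z) (x := b)); first by left.
    move=> y z [->|/bnb [h -> hb]] yz; first by right.
    by left; rewrite hb; exact: leaf_ga yz.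
  have [h E _] := bnb _ gb; case: (nleaf (g^-1 * h)).
  by rewrite actM -E actK.
have nbr_b c : adj b c -> c = a.
  by move=> bc; apply: contrapT => ca; apply: leaf_b; exists c.
have two z : z = a \/ z = b.
  apply: (adj_closed (P := fun z => z = a \/ z = b) (x := a)); first by left.
  by move=> y w [->|->]; [move/nbr_a|move/nbr_b] => ->; [right|left].
have [gb|//] := two (act g b).
have [ga|ga] := two (act g a).
  by have := src_neq_tgt treeT (eact g e); rewrite src_eact tgt_eact ga gb eqxx.
case: (@eact_neq_rev g e); exact: dedge_eq.
Qed.

(** A path from [tgt e] into the half-tree of [f] has to cross all [n] edges of [l], which bounds
    its length from below. *)
Lemma descending_chain (e : dedge T) n : exists f (l : seq (dedge T)),
  [/\ size l = n, uniq l, ele f e, f \notin l & forall z, z \in l ->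
    ele f z /\ ele z e].
Proof.
elim: n => [|n [f [l [sl Ul fe fl H]]]]; first by exists e, [::]; split=> //;
  exact: ele_refl.
have [f' [f'f nE]] := no_leaf f; exists f', (f :: l); split.
- by rewrite /= sl.
- by rewrite /= fl.
- exact: ele_trans fe.
- rewrite in_cons negb_or; apply/andP; split; first exact/eqP.
  apply/negP => /H [ff' _]; apply: nE; exact: (ele_anti treeT).
- move=> z; rewrite in_cons => /orP[/eqP -> //|/H [fz ze]]; split=> //.
  exact: ele_trans fz.
Qed.

Definition aset (v : T) (e : dedge T) : set G := [set g | side e (act g v)].

Definition estab (e : dedge T) : set G := edge_stab (src e) (tgt e).

Lemma estabP e g : estab e g <-> eact g e = e.
Proof.
split=> [[? ?]|E]; first exact: dedge_eq.
by split; [rewrite -src_eact E|rewrite -tgt_eact E].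
Qed.

(** For [g] in this set, the edge [g^-1 e] separates [v] from [w]. There are finitely many such
    edges, and the elements giving the same one form a right coset of [estab e]. *)
Lemma aset_change_vertex v w e :
  Hfinite (estab e) (aset v e `&` ~` aset w e).
Proof.
have [s Hs] := separating_finite treeT v w.
apply: (@Hfinite_by _ _ (fun g => eact g^-1 e) s) => [g [ev ew]|g g' _ _ E].
  apply: Hs; first by rewrite -(side_act g) eactVK.
  by rewrite -(side_act g) eactVK.
by apply/estabP; rewrite eactM -E eactVK.
Qed.

(* Vertices of one estab-orbit lie at the same distance of the fixed end
   [tgt e], but the half-tree contains translates arbitrarily far away. *)
Lemma aset_infinite v e : ~ Hfinite (estab e) (aset v e).
Proof.
move=> fin; have {fin} [F Ff AF] : Hfinite (estab e) (aset (src e) e).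
  apply: (@sub_Hfinite _ _ _ (aset v e `|` (aset (src e) e `&` ~` aset v e))).
    by move=> g; have [|] := pselect (aset v e g); [left|right].
  exact: HfiniteU fin (aset_change_vertex _ _ _).
move/finite_seqP: Ff AF => [s ->] AF.
have [N HN] : exists N, forall g, g \in s -> exists p,
    [/\ path (@adj G T) (tgt e) p, last (tgt e) p = act g (src e) & size p <= N].
  elim: s {AF} => [|g s [N HN]]; first by exists 0.
  have [_ _ /(_ (tgt e) (act g (src e))) [p ep Ep] _] := treeT.
  exists (maxn N (size p)) => h; rewrite in_cons => /orP[/eqP ->|/HN [q [eq Eq
    sq]]].
    by exists p; rewrite leq_maxr.
  by exists q; rewrite leq_max sq.
have [f [l [sl Ul fe fl Hl]]] := descending_chain e N.+1.
(* If [f] is a translate of [rev e], only its target is known to be a translate of [src e]; the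
   target still lies in every half-tree of [l], since [f] is not in [l]. *)
have [g xf] : exists g, forall z, z \in l -> side z (act g (src e)).
  have [g [E|E]] := dedge_orbit e f; exists g => z /[dup] zl /Hl [fz _].
    by apply/fz; rewrite E; exact: src_side.
  apply: contrapT => nz; have [E1 E2] : src f = src z /\ tgt f = tgt z.
    apply: (side_crossing (dedgeP f)); first exact/fz/src_side.
    by rewrite E.
  by move: fl; rewrite (dedge_eq E1 E2) zl.
have Ag : aset (src e) e g.
  case: l sl xf {Ul fl} Hl => // z l _ /(_ z (mem_head _ _)) zg.
  by case/(_ z (mem_head _ _)) => _; exact.
have [h He [k sk hk]] := AF _ Ag.
have [p [ep Ep sp]] := HN k sk.
have bp : path (@adj G T) (tgt e) (map (act h) p).
  have [_ <-] := He; rewrite path_map; apply: sub_path ep => u w.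
  by rewrite /= adj_act.
have Ebp : last (tgt e) (map (act h) p) = act g (src e).
  by rewrite -hk actM -Ep; have [_ {1}<-] := He; rewrite last_map.
suff : size l <= N by rewrite sl ltnn.
apply: leq_trans sp.
pose U (z : dedge T) := (tgt z, src z).
rewrite -(size_map U) -(size_map (act h) p).
have -> : size (map (act h) p) = size (path_pairs (tgt e) (map (act h) p)).
  by rewrite size_zip /= (minn_idPr _).
apply: uniq_leq_size.
  by rewrite map_inj_uniq // => y z [? ?]; apply: dedge_eq.
move=> _ /mapP[z zl ->]; have [_ ze] := Hl _ zl.
apply: (@sep_path _ _ (rev z)) => //.
  by apply/(side_rev treeT) => /ze; exact: (tgt_nside treeT).
by rewrite Ebp => /(side_rev treeT); apply; exact: xf.
Qed.

End Splitting.

(** * Almost invariant sets and almost inclusion *)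

Section AlmostInvariance.
Context {G : groupType}.
Implicit Types (A B C R : set G) (g k : G).
Local Open Scope group_scope.
Local Open Scope classical_set_scope.

Lemma translateE g A : translate g A = [set x | A (g^-1 * x)].
Proof.
apply/seteqP; split=> [_ [x Ax <-]|x Ax]; first by rewrite /= mulKg.
by exists (g^-1 * x) => //; rewrite mulVKg.
Qed.

Lemma translate1 A : translate 1 A = A.
Proof. by rewrite translateE invg1; apply/seteqP; split=> x /=; rewrite mul1g. Qed.

Lemma translateM g h A : translate (g * h) A = translate g (translate h A).
Proof. by rewrite !translateE; apply/seteqP; split=> x /=; rewrite invgM mulgA. Qed.

Lemma translateC g A : translate g (~` A) = ~` translate g A.
Proof. by rewrite !translateE. Qed.

Lemma stabE A g : stab A g <-> translate g A = A. Proof. by []. Qed.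

Lemma stab_mul A h x : stab A h -> A (h * x) <-> A x.
Proof. by move=> /stabE E; rewrite -{1}E translateE /= mulKg. Qed.

Lemma stab_divg A g h : stab A g -> stab A h -> stab A (g^-1 * h).
Proof.
by move=> /stabE Eg /stabE Eh; apply/stabE;
  rewrite translateM Eh -{1}Eg -translateM mulVg translate1.
Qed.

Lemma stabV A g : stab A g -> stab A g^-1.
Proof. by move=> Ag; rewrite -[g^-1]mulg1; apply: stab_divg Ag (translate1 A). Qed.

Lemma stabC A : stab (~` A) = stab A.
Proof.
apply/seteqP; split=> g /stabE E; apply/stabE; last by rewrite translateC E.
by apply: setC_inj; rewrite -translateC.
Qed.

Lemma stab_translate g A x : stab A x -> stab (translate g A) (g * x * g^-1).
Proof.
by move=> /stabE E; apply/stabE; rewrite -translateM mulgVK translateM E.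
Qed.

(** Invariance up to small sets under right translations, together with nontriviality. One half of
    each symmetric difference is enough, the other half being obtained from [k^-1]. *)
Definition almost_inv A :=
  [/\ forall k, small A (A `&` [set x | ~ A (x * k)]),
      ~ small A A & ~ small A (~` A)].

(** Unlike [ai_le], this allows other corners to be small too; among almost invariant sets it is a
    preorder. *)
Definition asub A B := small A (A `&` ~` B).

Definition aeq A B := asub A B /\ asub B A.

Lemma small_translate g A R : small A R -> small (translate g A) (translate g R).
Proof.
case=> F Ff RF; exists [set g * x | x in F]; first exact: finite_image.
move=> _ [x /RF [h Ah [y Fy <-]] <-].
exists (g * h * g^-1); first exact: stab_translate.
by exists (g * y); [exists y|rewrite -!mulgA mulKg].
Qed.

Lemma almost_invC A : almost_inv A -> almost_inv (~` A).
Proof.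
case=> inv nA nA'; rewrite /almost_inv /small stabC setCK; split=> // k.
apply: sub_Hfinite (Hfinite_mulr k (inv k^-1)) => x [nAx /contrapT Axk].
by split=> //=; rewrite mulgK.
Qed.

Lemma almost_inv_translate g A : almost_inv A -> almost_inv (translate g A).
Proof.
have back R : small (translate g A) (translate g R) -> small A R.
  by move/(small_translate g^-1); rewrite -!translateM mulVg !translate1.
case=> inv nA nA'; split=> [k||/=]; last 1 [by rewrite -translateC => /back].
  apply: sub_Hfinite (small_translate g (inv k)) => x.
  by rewrite !translateE => -[/= ? ?]; split=> //=; rewrite -mulgA.
by move/back.
Qed.

(* For [x] in [R] and [l] in [L] with [x = l * f], the element [l * g] is
   outside [A], so that [x] is moved out of [A] by right multiplication by
   [f^-1 * g], one of finitely many elements. *)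
Lemma small_of_Hfinite L A R g : almost_inv A -> R `<=` A -> Hfinite L R ->
  (forall l, L l -> ~ A (l * g)) -> small A R.
Proof.
case=> inv _ _ RA [F Ff RF] Lg.
have [s Es] := (finite_seqP F).1 Ff.
have : small A (\big[setU/set0]_(f <- s) (A `&` [set x | ~ A (x * (f^-1 * g))])).
  by elim/big_ind: _ => [|? ? ? ?|i _]; [exact: Hfinite0|exact: HfiniteU|exact:
    inv].
apply: sub_Hfinite => x Rx; have [l Ll [f Ff' xE]] := RF _ Rx.
rewrite -bigcup_seq; exists f; first by move: Ff'; rewrite Es.
by split; [exact: RA|rewrite /= -xE mulgA mulgK; exact: Lg].
Qed.

(** As [B] is not small, it contains a coset of its stabilizer outside the finitely many cosets that
    cover the part of [B] outside [C]. This provides the coset required by [small_of_Hfinite]. *)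
Lemma exists_stab_orbit B C : ~ small B B -> small B (B `&` ~` C) ->
  exists g, forall k, stab B k -> C (k * g).
Proof.
move=> nB [F Ff BF].
have [g Bg ng] : exists2 g, B g & ~ exists2 k, stab B k & exists2 f, F f &
  k * f = g.
  by apply: contrapT => H; apply: nB; exists F => // g Bg;
    apply: contrapT => ?; apply: H; exists g.
exists g => k Bk; apply: contrapT => nC.
have [|l Bl [f Ff' E]] := BF (k * g); first by split=> //; apply/stab_mul.
apply: ng; exists (k^-1 * l); first exact: stab_divg.
by exists f => //; rewrite -mulgA E mulKg.
Qed.

Lemma sub_asub A B : A `<=` B -> asub A B.
Proof. by rewrite -setD_eq0 setDE /asub => ->; exact: Hfinite0. Qed.

Lemma asub_refl A : asub A A. Proof. exact: sub_asub. Qed.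

(** Both sides speak of the same corner; the content is the passage from the stabilizer of [A] to
    that of [B]. *)
Lemma asubC A B : almost_inv A -> almost_inv B -> asub A B -> asub (~` B) (~` A).
Proof.
move=> [_ nA _] aiB AB; have [g Hg] := exists_stab_orbit nA AB.
rewrite /asub setCK setIC.
apply: (small_of_Hfinite (g := g) (almost_invC aiB) _ AB) => [x [//]|l Al].
by move=> nB; apply: nB; exact: Hg.
Qed.

Lemma asubC_iff A B : almost_inv A -> almost_inv B ->
  asub (~` B) (~` A) <-> asub A B.
Proof.
move=> aiA aiB; split; last exact: asubC.
by move/asubC; rewrite !setCK; apply; exact: almost_invC.
Qed.

(** The part of [A] inside [B] but outside [C] is finite for the stabilizer of [B] only.
    Contraposition gives a coset of this stabilizer outside [A], so that the part is small for [A]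
    as well. *)
Lemma asub_trans A B C : almost_inv A -> almost_inv B -> almost_inv C ->
  asub A B -> asub B C -> asub A C.
Proof.
move=> aiA aiB aiC AB BC.
have nAB := asubC aiA aiB AB.
have [_ nB _] := almost_invC aiB.
have [g Hg] := exists_stab_orbit nB nAB; rewrite stabC in Hg.
apply: (@sub_Hfinite _ _ _ ((A `&` ~` B) `|` (A `&` (B `&` ~` C)))).
  by move=> x [Ax nCx]; have [|] := pselect (B x); [right|left].
apply: HfiniteU AB _; apply: (small_of_Hfinite (g := g) aiA _ _ Hg) => [x []//|].
by apply: sub_Hfinite BC => x [].
Qed.

Lemma asub_translate g A B : asub A B -> asub (translate g A) (translate g B).
Proof.
by move/(small_translate g); apply: sub_Hfinite => x; rewrite !translateE.
Qed.

Lemma asub_both A B : almost_inv A -> asub A B -> asub A (~` B) -> False.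
Proof.
case=> _ nA _ AB AB'; apply: nA; apply: sub_Hfinite (HfiniteU AB AB') => x Ax.
by have [|] := pselect (B x); [right; rewrite setCK|left].
Qed.

Lemma asub_bothC A B : almost_inv A -> almost_inv B ->
  asub A B -> asub (~` A) B -> False.
Proof.
move=> aiA aiB /(asubC aiA aiB) h /(asubC (almost_invC aiA) aiB).
exact: asub_both (almost_invC aiB) h.
Qed.

Lemma aeq_refl A : aeq A A.
Proof. by split; exact: asub_refl. Qed.

Lemma aeq_sym A B : aeq A B -> aeq B A.
Proof. by case. Qed.

Lemma aeq_trans A B C : almost_inv A -> almost_inv B -> almost_inv C ->
  aeq A B -> aeq B C -> aeq A C.
Proof.
by move=> aiA aiB aiC [AB BA] [BC CB]; split;
  [exact: asub_trans AB BC|exact: asub_trans CB BA].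
Qed.

Lemma aeqC A B : almost_inv A -> almost_inv B -> aeq A B -> aeq (~` A) (~` B).
Proof. by move=> aiA aiB [AB BA]; split; exact: asubC. Qed.

Lemma aeq_translate g A B : aeq A B -> aeq (translate g A) (translate g B).
Proof. by case=> AB BA; split; exact: asub_translate. Qed.

Lemma not_crosses A B : ~ crosses A B ->
  [\/ asub A B, asub A (~` B), asub (~` A) B | asub (~` A) (~` B)].
Proof.
rewrite /asub /small stabC setCK => nc; apply: contrapT => H; apply: nc.
by split=> h; apply: H; [exact: Or42|exact: Or41|exact: Or44|exact: Or43].
Qed.

Lemma ai_le_asub A B : ai_le A B -> asub A B.
Proof. by rewrite /asub; case=> [->|[]//]; exact: Hfinite0. Qed.

End AlmostInvariance.

(** * Almost inclusion between edges of one tree *)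

Section TreeSets.
Context {G : groupType} (T : ggraph G).
Local Open Scope group_scope.
Local Open Scope classical_set_scope.
Hypothesis splitT : is_splitting T.
Let treeT := splitting_tree splitT.
Implicit Types (v : T) (e : dedge T).

Lemma aset_rev v e : aset v (rev e) = ~` aset v e.
Proof. by apply/seteqP; split=> g; rewrite /aset /= (side_rev treeT). Qed.

Lemma aset_eact v g e : aset v (eact g e) = translate g (aset v e).
Proof.
rewrite translateE; apply/seteqP; split=> x; rewrite /aset /= actM.
  by rewrite -(side_act g^-1) eactK.
by rewrite -(side_act g) actVK.
Qed.

Lemma aset_sub v e f : ele e f -> aset v e `<=` aset v f.
Proof. by move=> ef g; apply: ef. Qed.

(** The equality of stabilizers in [arises_from], for all edges at once: it passes from one edge to
    its translates and their reverses, hence to every edge. *)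
Definition exact_stab v := forall e, stab (aset v e) = estab e.

Lemma exact_stab_of v e : stab (aset v e) = estab e -> exact_stab v.
Proof.
have rv f : stab (aset v f) = estab f -> stab (aset v (rev f)) = estab (rev f).
  rewrite aset_rev stabC => ->; apply/seteqP; split=> g /estabP E; apply/estabP.
    by rewrite -rev_eact E.
  by apply: (can_inj (@revK _ T)); rewrite rev_eact.
have ac h f : stab (aset v f) = estab f ->
  stab (aset v (eact h f)) = estab (eact h f).
  rewrite aset_eact => E.
  have sub g : estab f (h^-1 * g * h) <-> estab (eact h f) g.
    rewrite !estabP -!mulgA !eactM; split=> [E'|->]; last by rewrite eactK.
    by apply: (can_inj (eactK (h^-1))); rewrite eactK.
  apply/seteqP; split=> g; rewrite -sub -E.
    by move/(stab_translate h^-1); rewrite -translateM mulVg translate1 invgK.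
  by move/(stab_translate h); rewrite !mulgA mulgV mul1g mulgK.
move=> E f; have [g [->|->]] := dedge_orbit splitT e f; first exact: ac.
exact/ac/rv.
Qed.

Lemma aset_almost_inv v e : exact_stab v -> almost_inv (aset v e).
Proof.
move=> ex; rewrite /almost_inv /small ex; split=> [k||].
- apply: sub_Hfinite (aset_change_vertex splitT v (act k v) e) => x [? nx].
  by split=> // ek; apply: nx; rewrite /aset /= actM.
- exact: aset_infinite.
- have -> : estab e = estab (rev e).
    apply/seteqP; split=> g /estabP E; apply/estabP; first by rewrite -rev_eact E.
    by apply: (can_inj (@revK _ T)); rewrite rev_eact.
  by rewrite -aset_rev; exact: aset_infinite.
Qed.

Lemma aset_change v w e : exact_stab v -> asub (aset v e) (aset w e).
Proof. by move=> ex; rewrite /asub /small ex; exact: aset_change_vertex. Qed.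

Lemma arises_from_exact H X : arises_from T H X -> exists v e,
  [/\ exact_stab v, H = estab e & X = aset v e].
Proof.
case=> v [a [b [ab HE HX XE]]]; exists v, (mk_dedge ab); split=> //.
apply: (@exact_stab_of _ (mk_dedge ab)).
by rewrite -[aset _ _]/[set g | points_away a b (act g v)] -XE -HX.
Qed.

Lemma Sigma_aset v e A : Sigma (aset v e) A -> exists f, A = aset v f.
Proof.
case=> g [->|->]; first by exists (eact g e); rewrite aset_eact.
by exists (eact g (rev e)); rewrite aset_eact aset_rev.
Qed.

(** The two other cases of [nested] would make one set, or two complementary sets, almost included
    in contradictory ways. The direction stays open, as equivalent edges may be ordered either
    way. *)
Lemma asub_comparable v e f : exact_stab v ->
  asub (aset v e) (aset v f) -> ele e f \/ ele f e.
Proof.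
move=> ex ef; have ai z := @aset_almost_inv v z ex.
case: (nested treeT e f) => h; [by left|by right| |].
  have /sub_asub := aset_sub (v := v) h; rewrite aset_rev.
  by case/(asub_both (ai e) ef).
move: h => /(ele_revl treeT) /(aset_sub (v := v)) /sub_asub; rewrite aset_rev.
by case/(asub_bothC (ai e) (ai f) ef).
Qed.

End TreeSets.

(** * Isomorphisms of trees from isomorphisms of ordered edge sets *)

Section Isomorphisms.
Context {G : groupType}.
Implicit Types (S T : ggraph G).
Local Open Scope group_scope.
Local Open Scope classical_set_scope.

Lemma rel_gg_iso S T (R : S -> T -> Prop) :
    (forall x, exists y, R x y) -> (forall y, exists x, R x y) ->
    (forall x y y', R x y -> R x y' -> y = y') ->
    (forall x x' y, R x y -> R x' y -> x = x') ->
    (forall x y x' y', R x y -> R x' y' -> adj x x' <-> adj y y') ->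
    (forall g x y, R x y -> R (act g x) (act g y)) ->
  gg_iso S T.
Proof.
move=> /choice[f Rf] /choice[f' Rf'] Rl Rr Radj Ract; exists f; split.
- by exists f' => [x|y]; [apply: Rr (Rf' _) (Rf _)|apply: Rl (Rf _) (Rf' _)].
- by move=> x y; apply/idP/idP => /(Radj _ _ _ _ (Rf x) (Rf y)).
- by move=> g x; apply: Rl (Rf _) _; apply: Ract.
Qed.

Lemma gg_iso_refl T : gg_iso T T.
Proof. by exists id; split=> //; exists id. Qed.

Lemma gg_iso_sym S T : gg_iso S T -> gg_iso T S.
Proof.
case=> f [[f' fK f'K] fadj fact]; exists f'; split; first by exists f.
- by move=> x y; rewrite -fadj !f'K.
- by move=> g x; apply: (can_inj fK); rewrite fact !f'K.
Qed.

Lemma gg_iso_trans S T U : gg_iso S T -> gg_iso T U -> gg_iso S U.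
Proof.
case=> f [bf fadj fact] [h [bh hadj hact]]; exists (h \o f); split.
- exact: bij_comp.
- by move=> x y; rewrite /= hadj fadj.
- by move=> g x; rewrite /= fact hact.
Qed.

(** Two vertices correspond when they lie in corresponding half-trees. By [src_sideP] the sources of
    corresponding edges do, and by [sides_separate] the correspondence is one to one. *)
Lemma gg_iso_of_order S T (Phi : dedge S -> dedge T -> Prop) :
    is_splitting S -> is_splitting T ->
    (forall e, exists f, Phi e f) -> (forall f, exists e, Phi e f) ->
    (forall e f e' f', Phi e f -> Phi e' f' -> ele e e' <-> ele f f') ->
    (forall e f, Phi e f -> Phi (rev e) (rev f)) ->
    (forall g e f, Phi e f -> Phi (eact g e) (eact g f)) ->
  gg_iso S T.
Proof.
move=> spS spT tl tr ord prev pact.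
have trS := splitting_tree spS; have trT := splitting_tree spT.
have fl e f f' : Phi e f -> Phi e f' -> f = f'.
  by move=> h h'; apply: (ele_anti trT); apply/(ord _ _ _ _ _ _).1; eauto;
    exact: ele_refl.
have fr e e' f : Phi e f -> Phi e' f -> e = e'.
  by move=> h h'; apply: (ele_anti trS); apply/(ord _ _ _ _ _ _).2; eauto;
    exact: ele_refl.
pose R (x : S) (y : T) := forall e f, Phi e f -> side e x <-> side f y.
have Rsrc e f : Phi e f -> R (src e) (src f).
  move=> ef e' f' ef'; rewrite (src_sideP trS) (src_sideP trT).
  have -> : ele e e' <-> ele f f' by exact: ord.
  have -> : ele (rev e) e' <-> ele (rev f) f' by apply: ord => //; exact: prev.
  suff -> : e' = rev e <-> f' = rev f by [].
  by split=> E; subst; [apply: fl ef' (prev _ _ ef)|apply: fr ef' (prev _ _ ef)].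
have Rl x y y' : R x y -> R x y' -> y = y'.
  move=> h h'; apply: (sides_separate trT) => f; have [e ef] := tr f.
  by rewrite -(h _ _ ef) (h' _ _ ef).
have Rr x x' y : R x y -> R x' y -> x = x'.
  move=> h h'; apply: (sides_separate trS) => e; have [f ef] := tl e.
  by rewrite (h _ _ ef) (h' _ _ ef).
apply: (rel_gg_iso (R := R)) => //.
- move=> x; have [e <-] := vertex_incident spS x; have [f ef] := tl e.
  by exists (src f); exact: Rsrc.
- move=> y; have [f <-] := vertex_incident spT y; have [e ef] := tr f.
  by exists (src e); exact: Rsrc.
- move=> x y x' y' xy xy'; split=> a.
    have [f ef] := tl (mk_dedge a).
    have -> : y = src f by apply: Rl xy (Rsrc _ _ ef).
    have -> : y' = tgt f by apply: Rl xy' (Rsrc _ _ (prev _ _ ef)).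
    exact: dedgeP.
  have [e ef] := tr (mk_dedge a).
  have -> : x = src e by apply: Rr xy (Rsrc _ _ ef).
  have -> : x' = tgt e by apply: Rr xy' (Rsrc _ _ (prev _ _ ef)).
  exact: dedgeP.
- move=> g x y xy e f ef; have := xy _ _ (pact g^-1 _ _ ef).
  by rewrite -(side_act g) eactVK -(side_act g (eact g^-1 f)) eactVK.
Qed.

End Isomorphisms.

(** * Shifts along chains of equivalent edges *)

Section EquivalentEdges.
Context {G : groupType}.
Local Open Scope group_scope.
Local Open Scope classical_set_scope.

Lemma stab_pigeonhole (A R : set G) (y : nat -> G) : small A R ->
  (forall n, R (y n)) -> exists n m, n < m /\ stab A (y n * (y m)^-1).
Proof.
case=> F /finite_seqP[s ->] RF Ry.
have /choice[f Hf] n : exists f, f \in s /\ exists2 h, stab A h & h * f = y n.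
  by have [h Ah [f Ff E]] := RF _ (Ry n); exists f; split=> //; exists h.
have /(uniqPn 1)[i [j [ij]]] : ~~ uniq (map f (iota 0 (size s).+1)).
  apply/negP => U; suff : (size s).+1 <= size s by rewrite ltnn.
  rewrite -[X in X <= _](size_iota 0) -(size_map f).
  by apply: uniq_leq_size U _ => _ /mapP[n _ ->]; case: (Hf n).
rewrite size_map size_iota => js.
have is' := ltn_trans ij js.
rewrite !(nth_map 0) ?size_iota // !nth_iota // !add0n => E.
exists i, j; split=> //; have [_ [h Ah <-]] := Hf i; have [_ [h' Ah' <-]] := Hf j.
rewrite E invgM mulgA mulgK -[h]invgK; by apply: stab_divg; exact: stabV.
Qed.

Lemma eact_expg_le (T : ggraph G) (e : dedge T) g n :
  ele e (eact g e) -> ele e (eact (g ^+ n) e).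
Proof.
move=> ege; elim: n => [|n IHn]; first by rewrite expg0 eact1.
by rewrite expgS eactM; apply: (ele_trans ege); rewrite ele_act.
Qed.

Lemma eact_expg_fixed (T : ggraph G) (e : dedge T) g n : is_tree (@adj G T) ->
  ele e (eact g e) -> eact (g ^+ n.+1) e = e -> eact g e = e.
Proof.
move=> treeT ege E; apply: (ele_anti treeT) => //.
by rewrite -{2}E expgS eactM ele_act; exact: eact_expg_le.
Qed.

(* A strict increase of [A] under [g] makes the points [g^n x] with
   [x] in [gA \ A] lie in [A] exactly for n < 0, whereas the points lying in B
   form a terminal segment; so A and B differ by infinitely many of them. *)
Lemma no_opposite_shift (S T : ggraph G) (v : S) (w : T) e f g :
    is_splitting S -> exact_stab v -> is_splitting T -> exact_stab w ->
    aeq (aset v e) (aset w f) ->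
  ele e (eact g e) -> ele (eact g f) f -> eact g e = e.
Proof.
move=> spS exv spT exw [AB BA] ege gff; apply: contrapT => nge.
have trS := splitting_tree spS.
have aiA : almost_inv (aset v e) by exact: aset_almost_inv.
have aiB : almost_inv (aset w f) by exact: aset_almost_inv.
set A := aset v e in AB BA aiA; set B := aset w f in AB BA aiB.
have Ag x : A x -> A (g^-1 * x).
  by move=> /(aset_sub ege); rewrite aset_eact translateE.
have Bg x : B (g^-1 * x) -> B x.
  by move=> Bx; apply: (aset_sub gff); rewrite aset_eact translateE.
have [x Ax nAx] : exists2 x, A (g^-1 * x) & ~ A x.
  apply: contrapT => H; apply: nge; apply/estabP; rewrite -exv; apply/stabE.
  rewrite translateE; apply/seteqP; split=> x /=; last exact: Ag.
  by move=> h; apply: contrapT => ?; apply: H; exists x.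
have BX n y : B y -> B (g ^+ n * y).
  by move=> By; elim: n => [|n IHn]; rewrite ?mul1g // expgS -mulgA; apply: Bg;
    rewrite mulKg.
have AX n y : A y -> A ((g ^+ n)^-1 * y).
  by move=> Ay; elim: n => [|n IHn]; rewrite ?invg1 ?mul1g // expgSr invgM
    -mulgA; exact: Ag.
have fixed n : stab A (g ^+ n.+1) -> False.
  by rewrite exv => /estabP /(eact_expg_fixed trS ege).
have [[N BN]|nB] := pselect (exists N, B (g ^+ N * x)).
  have BA' := asubC aiB aiA BA; rewrite /asub /small stabC setCK in BA'.
  have [|n [m [nm]]] := @stab_pigeonhole A _ (fun n => g ^+ (n + N) * x) BA'.
    move=> n; split; last by rewrite expgnDr -mulgA; exact: BX.
    by move=> /(AX (n + N)); rewrite mulKg.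
  rewrite invgM mulgA mulgK => /stabV; rewrite invgM invgK.
  have -> : m + N = ((m - n.+1).+1 + (n + N))%N.
    by rewrite -subSn // subSS addnA subnK // ltnW.
  by rewrite expgnDr mulgK; exact: fixed.
have [|n [m [nm]]] := @stab_pigeonhole A _ (fun n => (g ^+ n.+1)^-1 * x) AB.
  move=> n; split; first by rewrite expgS invgM -mulgA; exact: AX.
  by move=> /(BX n.+1); rewrite mulVKg => h; apply: nB; exists 0; rewrite mul1g.
rewrite invgM mulgA mulgK invgK.
have -> : m.+1 = (n.+1 + (m - n.+1).+1)%N by rewrite addnS subnKC.
by rewrite expgnDr mulKg; exact: fixed.
Qed.

End EquivalentEdges.

(** * Reflections of a chain of equivalent edges *)

Section Flips.
Context {G : groupType} (T : ggraph G) (v : T).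
Local Open Scope group_scope.
Local Open Scope classical_set_scope.
Hypotheses (spT : is_splitting T) (exv : exact_stab v).
Let treeT := splitting_tree spT.
Implicit Types (e f z : dedge T) (g k : G).

Definition eeq e f := aeq (aset v e) (aset v f).

Let ai e : almost_inv (aset v e). Proof. exact: aset_almost_inv. Qed.

Lemma eeq_refl e : eeq e e. Proof. exact: aeq_refl. Qed.

Lemma eeq_sym e f : eeq e f -> eeq f e. Proof. exact: aeq_sym. Qed.

Lemma eeq_trans e f z : eeq e f -> eeq f z -> eeq e z.
Proof. exact: aeq_trans. Qed.

Lemma eeq_rev e f : eeq e f -> eeq (rev e) (rev f).
Proof. by rewrite /eeq !aset_rev //; exact: aeqC. Qed.

Lemma eeq_act g e f : eeq e f -> eeq (eact g e) (eact g f).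
Proof. by rewrite /eeq !aset_eact; exact: aeq_translate. Qed.

Lemma eeq_comparable e f : eeq e f -> ele e f \/ ele f e.
Proof. by case=> ef _; exact: asub_comparable exv ef. Qed.

(** [k] maps the chain of the edges equivalent to [e] to itself up to reversal, turning its
    direction around; the mirror image of [e] in the chain is [eact k (rev e)]. *)
Definition flips k e := eeq (eact k e) (rev e).

Lemma flips_eeq k e f : eeq e f -> flips k e -> flips k f.
Proof.
move=> ef ke; apply: eeq_trans (eeq_rev ef); apply: eeq_trans ke.
exact/eeq_act/eeq_sym.
Qed.

Lemma flips_rev k e : flips k e -> eeq (eact k (rev e)) e.
Proof. by move=> /eeq_rev; rewrite revK rev_eact. Qed.

(** The element [k * k] moves the equivalent edges [e] and [eact k (rev e)] in opposite directions,
    so [no_opposite_shift] forbids any motion. *)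
Lemma flips_sq k e : flips k e -> eact k (eact k e) = e.
Proof.
move=> ke; have kre := flips_rev ke.
have kke : eeq (eact k (eact k e)) e by apply: eeq_trans kre; exact: eeq_act.
have [le|le] := eeq_comparable kke; last first.
  rewrite -eactM; apply: (no_opposite_shift (f := eact k (rev e)) spT exv spT exv).
  - exact: eeq_sym.
  - by rewrite eactM.
  - rewrite eactM !ele_act -!rev_eact (ele_rev treeT) //.
have E : eact (k * k)^-1 e = e.
  apply: (no_opposite_shift (f := eact k (rev e)) spT exv spT exv).
  - exact: eeq_sym.
  - by rewrite -(ele_act (k * k)) eactVK eactM.
  - rewrite -(ele_act (k * k)) eactVK eactM ele_act -!rev_eact (ele_rev treeT) //.
by rewrite -{1}E -eactM eactVK.
Qed.

(** No edge of the chain lies strictly between [e] and its mirror image. *)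
Definition middle k e := ele e (eact k (rev e)) /\
  forall z, eeq z e -> ele e z -> ele z (eact k (rev e)) ->
    z = e \/ z = eact k (rev e).

Lemma rev_flipsK k e : flips k e -> eact k (rev (eact k (rev e))) = e.
Proof. by move=> ke; rewrite rev_eact revK flips_sq. Qed.

(* A flip acts as a reflection on the chain of the edges equivalent to e. *)
Lemma exists_middle k e : flips k e -> exists2 f, eeq f e & middle k f.
Proof.
move=> ke; wlog ele_e : e ke / ele e (eact k (rev e)).
  move=> W; have [|le] := eeq_comparable (eeq_sym (flips_rev ke)); first exact: W.
  have kre := flips_rev ke.
  have [||f fe mf] := W (eact k (rev e)).
  - exact: flips_eeq (eeq_sym kre) ke.
  - by rewrite rev_flipsK.
  - by exists f => //; exact: eeq_trans kre.
have [s Hs] := interval_finite treeT e (eact k (rev e)).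
have [n] := ubnP (size s); elim: n => // n IHn in e s ke ele_e Hs *.
rewrite ltnS => sn.
have [mid|/existsNP[z]] := pselect (forall z, eeq z e -> ele e z ->
    ele z (eact k (rev e)) -> z = e \/ z = eact k (rev e)).
  by exists e; [exact: eeq_refl|].
move=> /not_implyP[ze /not_implyP[ez /not_implyP[zk /not_orP[nze nzk]]]].
have kz : flips k z := flips_eeq (eeq_sym ze) ke.
have ek : ele e (eact k (rev z)).
  by rewrite -(rev_flipsK ke) ele_act (ele_rev treeT).
have kzk : ele (eact k (rev z)) (eact k (rev e)) by rewrite ele_act (ele_rev treeT).
(* Of [z] and its mirror image, the one below the other spans a smaller interval with its own mirror
   image. *)
have step f : eeq f e -> ele e f -> ele f (eact k (rev f)) ->
    ele (eact k (rev f)) (eact k (rev e)) -> ~ f = e ->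
    exists2 f0, eeq f0 e & middle k f0.
  move=> fe ef ff fk nfe; have [||||f0 f0f mf0] := IHn f [seq y <- s | y != e].
  - exact: flips_eeq (eeq_sym fe) ke.
  - exact: ff.
  - move=> y fy yk; rewrite mem_filter /=; apply/andP; split.
      by apply/eqP => ye; apply: nfe; apply: (ele_anti treeT) ef; rewrite -ye.
    by apply: Hs; [exact: ele_trans fy|exact: ele_trans yk fk].
  - apply: leq_trans sn; rewrite size_filter -(count_predC (pred1 e) s).
    rewrite -[X in X < _]add0n ltn_add2r -has_count has_pred1.
    by apply: Hs; [exact: ele_refl|].
  by exists f0 => //; exact: eeq_trans fe.
have [zz|zz] := eeq_comparable (eeq_sym (flips_rev kz)); first exact: (step z).
apply: (step (eact k (rev z))) => //.
- exact: eeq_trans (flips_rev kz) ze.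
- by rewrite rev_flipsK.
- by rewrite rev_flipsK.
- by move=> E; apply: nzk; rewrite -E rev_flipsK.
Qed.

(* With e and k e^-1 adjacent in the chain, whether g e lies below e^-1 is
   decided by the element g k^-1, which preserves the orientation. *)
Lemma middle_flips g k e : flips k e -> middle k e -> flips g e ->
  ele (eact g e) (rev e) <-> ele e (eact (g * k^-1) e).
Proof.
move=> ke [lek mid] ge; set h := g * k^-1.
have hE : eact h (eact k (rev e)) = eact g (rev e).
  by rewrite /h eactM eactK.
rewrite (ele_revr treeT) rev_eact -hE; split=> [le|le]; last first.
  by apply: ele_trans le _; rewrite ele_act.
have he : eeq (eact h e) e.
  rewrite /h eactM -{1}(flips_sq ke) eactK.
  exact: eeq_trans (eeq_act g ke) (flips_rev ge).
have [//|lh] := eeq_comparable (eeq_sym he).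
have hhe : eeq (eact h^-1 e) e by rewrite -{2}(eactK h e); exact/eeq_act/eeq_sym.
case: (mid _ hhe).
- by rewrite -(ele_act h) eactVK.
- by rewrite -(ele_act h) eactVK.
- by move=> E; rewrite -{2}E eactVK; exact: ele_refl.
move=> E; have := @eact_neq_rev _ _ spT g e; case.
by apply: (can_inj (@revK _ T)); rewrite revK rev_eact -hE -E eactVK.
Qed.

End Flips.

(** * Equivalent sets come from isomorphic splittings *)

Section Matching.
Context {G : groupType}.
Local Open Scope group_scope.
Local Open Scope classical_set_scope.

(** When [g] is a flip, equivalence of the sets does not decide whether [g e] lies below or above
    [rev e]. Placing [e] and [f] next to the centre of the same [k] makes the answers agree in the
    two trees. *)
Definition matched (S T : ggraph G) (v : S) (w : T) e f :=
  aeq (aset v e) (aset w f) /\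
  ((forall g, ~ flips v g e /\ ~ flips w g f) \/
   exists k, [/\ flips v k e, flips w k f, middle v k e & middle w k f]).

Lemma matched_sym (S T : ggraph G) (v : S) (w : T) e f :
  matched v w e f -> matched w v f e.
Proof.
case=> /aeq_sym fe H; split=> //; case: H => [H|[k [? ? ? ?]]]; last by right;
  exists k.
by left=> g; have [] := H g.
Qed.

Section Order.
Variables (S T : ggraph G) (v : S) (w : T).
Hypotheses (spS : is_splitting S) (exv : exact_stab v).
Hypotheses (spT : is_splitting T) (exw : exact_stab w).
Variables (e : dedge S) (f : dedge T).
Hypothesis ef : aeq (aset v e) (aset w f).

Let aiS z : almost_inv (aset v z). Proof. exact: aset_almost_inv. Qed.
Let aiT z : almost_inv (aset w z). Proof. exact: aset_almost_inv. Qed.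
Let efC := aeqC (aiS e) (aiT f) ef.

Lemma flips_transfer g : flips v g e -> flips w g f.
Proof.
rewrite /flips /eeq !aset_eact !aset_rev // => ge.
have tS : almost_inv (translate g (aset v e)) by exact: almost_inv_translate.
have tT : almost_inv (translate g (aset w f)) by exact: almost_inv_translate.
have cS := almost_invC (aiS e); have cT := almost_invC (aiT f).
apply: (aeq_trans tT cS cT _ efC); apply: (aeq_trans tT tS cS _ ge).
exact/aeq_translate/aeq_sym.
Qed.

(** Equivalence shows that [g f] and [f] are comparable. In the wrong order, [g] would shift
    equivalent edges in opposite directions and therefore fix [f]. *)
Lemma match_le g : ele (eact g e) e -> ele (eact g f) f.
Proof.
move=> gee; have : asub (aset w (eact g f)) (aset w f).
  have fe := aeq_sym ef.
  rewrite aset_eact; apply: (asub_trans _ (aiS (eact g e)) (aiT f)).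
  - exact: almost_inv_translate.
  - by rewrite aset_eact; apply: asub_translate; case: ef.
  - apply: (asub_trans (aiS _) (aiS e) (aiT f)); last by case: ef.
    exact/sub_asub/aset_sub.
case/(asub_comparable spT exw) => // fgf.
have -> : eact g f = f by exact: no_opposite_shift spT exw spS exv (aeq_sym ef)
  fgf gee.
exact: ele_refl.
Qed.

Lemma match_rev_asub g : ele (eact g e) (rev e) ->
  asub (aset w (eact g f)) (aset w (rev f)).
Proof.
move=> gee; rewrite aset_eact aset_rev //.
have tS : almost_inv (translate g (aset v e)) by exact: almost_inv_translate.
have tT : almost_inv (translate g (aset w f)) by exact: almost_inv_translate.
have cS := almost_invC (aiS e); have cT := almost_invC (aiT f).
apply: (asub_trans tT cS cT _ efC.1); apply: (asub_trans tT tS cS).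
  by apply: asub_translate; case: ef.
by rewrite -aset_eact -aset_rev //; exact/sub_asub/aset_sub.
Qed.

Lemma match_rev_asub' g : ele (rev e) (eact g e) ->
  asub (aset w (rev f)) (aset w (eact g f)).
Proof.
move=> gee; rewrite aset_eact aset_rev //.
have tS : almost_inv (translate g (aset v e)) by exact: almost_inv_translate.
have tT : almost_inv (translate g (aset w f)) by exact: almost_inv_translate.
have cS := almost_invC (aiS e); have cT := almost_invC (aiT f).
apply: (asub_trans cT cS tT efC.2); apply: (asub_trans cS tS tT).
  by rewrite -aset_eact -aset_rev //; exact/sub_asub/aset_sub.
by apply: asub_translate; case: ef.
Qed.

End Order.

Section OrderRev.
Variables (S T : ggraph G) (v : S) (w : T).
Hypotheses (spS : is_splitting S) (exv : exact_stab v).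
Hypotheses (spT : is_splitting T) (exw : exact_stab w).
Variables (e : dedge S) (f : dedge T).
Hypothesis M : matched v w e f.

Lemma match_ge g : ele e (eact g e) -> ele f (eact g f).
Proof.
rewrite -(ele_act g^-1) eactK => /(match_le spS exv spT exw M.1).
by rewrite -(ele_act g) eactVK.
Qed.

(** The wrong order makes [g] a flip of [f], hence of [e]. Then [middle_flips] reduces both
    comparisons to the orientation preserving element [g * k^-1], to which [match_ge] applies. *)
Lemma match_rev g : ele (eact g e) (rev e) -> ele (eact g f) (rev f).
Proof.
move=> le; have sub := match_rev_asub spS exv spT exw M.1 le.
have [//|le'] := asub_comparable spT exw sub.
have gf : flips w g f by split=> //; exact/sub_asub/aset_sub.
case: M => efq [/(_ g)[_ []//]|[k [ke kf me mf]]].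
have ge : flips v g e := flips_transfer spT exw spS exv (aeq_sym efq) gf.
apply/(middle_flips spT exw kf mf gf)/match_ge.
exact/(middle_flips spS exv ke me ge).
Qed.

End OrderRev.

(** In the wrong order, [match_rev] from T back to S gives [eact g e = rev e], an inverted edge. *)
Lemma match_rev' (S T : ggraph G) (v : S) (w : T) e f g :
    is_splitting S -> exact_stab v -> is_splitting T -> exact_stab w ->
    matched v w e f ->
  ele (rev e) (eact g e) -> ele (rev f) (eact g f).
Proof.
move=> spS exv spT exw M le.
have sub := match_rev_asub' spS exv spT exw M.1 le.
have [//|le'] := asub_comparable spT exw sub.
have le2 := match_rev spT exw spS exv (matched_sym M) le'.
by case: (@eact_neq_rev _ _ spS g e); exact: (ele_anti (splitting_tree spS)).
Qed.

(** The equivariant correspondence generated by the pair of [e] and [f], compatible with reversal.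
    It is a relation because its being a function is a consequence of order preservation. *)
Definition match_rel (S T : ggraph G) (e : dedge S) (f : dedge T) x y :=
  exists g, (x = eact g e /\ y = eact g f) \/
            (x = eact g (rev e) /\ y = eact g (rev f)).

Lemma match_rel_le (S T : ggraph G) (v : S) (w : T) e f :
    is_splitting S -> exact_stab v -> is_splitting T -> exact_stab w ->
    matched v w e f ->
  forall x y x' y', match_rel e f x y -> match_rel e f x' y' ->
    ele x x' -> ele y y'.
Proof.
move=> spS exv spT exw M.
have trS := splitting_tree spS; have trT := splitting_tree spT.
have move_ (U : ggraph G) (a b : dedge U) g h :
    ele (eact g a) (eact h b) <-> ele (eact (h^-1 * g) a) b.
  by rewrite eactM -[ele (eact h^-1 _) _](ele_act h) eactVK.
move=> _ _ _ _ [g [[-> ->]|[-> ->]]] [h [[-> ->]|[-> ->]]].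
- by rewrite !move_; exact: match_le M.1 _.
- by rewrite !move_; exact: match_rev M _.
- rewrite -!(ele_act g^-1 (eact g _)) !eactK -!eactM.
  exact: match_rev' M.
- rewrite -!rev_eact !ele_rev // !move_; exact: match_le M.1 _.
Qed.

Theorem gg_iso_of_aeq (S T : ggraph G) (v : S) (w : T) e f :
    is_splitting S -> exact_stab v -> is_splitting T -> exact_stab w ->
  aeq (aset v e) (aset w f) -> gg_iso S T.
Proof.
move=> spS exv spT exw ef.
have {e f ef} [e [f M]] : exists e f, matched v w e f.
  have [[k ke]|nk] := pselect (exists k, flips v k e); last first.
    exists e, f; split=> //; left=> g; split=> [ge|gf]; apply: nk; exists g => //.
    exact: (flips_transfer spT exw spS exv (aeq_sym ef) gf).
  have kf := flips_transfer spS exv spT exw ef ke.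
  have [e' ee' me'] := exists_middle spS exv ke.
  have [f' ff' mf'] := exists_middle spT exw kf.
  have aiS z : almost_inv (aset v z) by exact: aset_almost_inv.
  have aiT z : almost_inv (aset w z) by exact: aset_almost_inv.
  exists e', f'; split.
    apply: (aeq_trans (aiS _) (aiS e) (aiT _) ee').
    exact: (aeq_trans (aiS _) (aiT f) (aiT _) ef (aeq_sym ff')).
  right; exists k; split=> //; first exact: (flips_eeq spS exv (aeq_sym ee') ke).
  exact: (flips_eeq spT exw (aeq_sym ff') kf).
have M' := matched_sym M.
have rel_sym x y : match_rel e f x y -> match_rel f e y x.
  by case=> g [[-> ->]|[-> ->]]; exists g; [left|right].
apply: (gg_iso_of_order (Phi := match_rel e f)) => //.
- move=> x; have [g [->|->]] := dedge_orbit spS e x.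
    by exists (eact g f); exists g; left.
  by exists (eact g (rev f)); exists g; right.
- move=> x; have [g [->|->]] := dedge_orbit spT f x.
    by exists (eact g e); exists g; left.
  by exists (eact g (rev e)); exists g; right.
- move=> x y x' y' xy xy'; split; first exact: match_rel_le M _ _ _ _ xy xy'.
  exact: match_rel_le M' _ _ _ _ (rel_sym _ _ xy) (rel_sym _ _ xy').
- by move=> _ _ [g [[-> ->]|[-> ->]]]; exists g; rewrite !rev_eact ?revK;
    [right|left].
- by move=> h _ _ [g [[-> ->]|[-> ->]]]; exists (h * g); rewrite !eactM;
    [left|right].
Qed.

End Matching.

(** * The tree of a nested pocset with finite intervals *)

Lemma path_step (V : eqType) (e e' : rel V) x p : path e x p -> ~~ path e' x p ->
  exists p1 y z p2, [/\ x :: p = p1 ++ y :: z :: p2, e y z & ~~ e' y z].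
Proof.
elim: p x => [|z p IHp] x //= /andP[xz zp];
  rewrite negb_and => /orP[nxz|/(IHp _ zp)].
  by exists [::], x, z, p.
by case=> p1 [y [w [p2 [-> ? ?]]]]; exists (x :: p1), y, w, p2.
Qed.

Section Pocset.
Context {G : groupType} (n : nat) (tau : 'I_n -> ggraph G).
Local Open Scope group_scope.
Local Open Scope classical_set_scope.
Variables (E : eqType) (le : E -> E -> Prop) (star : E -> E) (ac : G -> E -> E).
Variable em : forall j, dedge (tau j) -> E.
Arguments em : clear implicits.
Hypothesis splits : forall j, is_splitting (tau j).
Hypothesis le_refl : forall e, le e e.
Hypothesis le_trans : forall e f z, le e f -> le f z -> le e z.
Hypothesis le_anti : forall e f, le e f -> le f e -> e = f.
Hypothesis starK : involutive star.
Hypothesis le_star : forall e f, le e f -> le (star f) (star e).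
Hypothesis ac1 : forall e, ac 1 e = e.
Hypothesis acM : forall g h e, ac (g * h) e = ac g (ac h e).
Hypothesis le_ac : forall g e f, le e f -> le (ac g e) (ac g f).
Hypothesis star_ac : forall g e, star (ac g e) = ac g (star e).
Hypothesis le_nested : forall e f, [\/ le e f, le f e,
  le e (star f) | le (star f) e].
Hypothesis le_both : forall e f, le e f -> le e (star f) -> False.
Hypothesis em_surj : forall e, exists j p, e = em j p.
Hypothesis em_index : forall j k p q, em j p = em k q -> j = k.
Hypothesis em_le : forall j p q, le (em j p) (em j q) <-> ele p q.
Hypothesis em_rev : forall j p, em j (rev p) = star (em j p).
Hypothesis em_ac : forall j g p, em j (eact g p) = ac g (em j p).
Hypothesis between : forall e j, exists a b, le (em j a) e /\ le e (em j b).
Hypothesis inhE : inhabited E.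

Let tree j := splitting_tree (splits j).

Lemma em_inj j : injective (em j).
Proof. by move=> p q E'; apply: (ele_anti (tree j)); apply/em_le; rewrite E'. Qed.

Lemma acK g : cancel (ac g) (ac g^-1).
Proof. by move=> e; rewrite -acM mulVg ac1. Qed.

Lemma acVK g : cancel (ac g^-1) (ac g).
Proof. by move=> e; rewrite -acM mulgV ac1. Qed.

Lemma le_acE g e f : le (ac g e) (ac g f) <-> le e f.
Proof. by split=> [/(le_ac g^-1)|]; rewrite ?acK //; exact: le_ac. Qed.

Lemma le_starE e f : le (star e) (star f) <-> le f e.
Proof. by split=> /le_star; rewrite ?starK. Qed.

Lemma le_starl e f : le (star e) f <-> le (star f) e.
Proof. by split=> /le_star; rewrite ?starK. Qed.

Lemma le_starr e f : le e (star f) <-> le f (star e).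
Proof. by split=> /le_star; rewrite ?starK. Qed.

Lemma le_both_left e f : le e f -> le (star e) f -> False.
Proof. by move=> /le_star fe /le_starl fe'; exact: le_both fe' fe. Qed.

(** By [between], the edges of tree [j] in this interval lie in an interval of tree [j], which is
    finite; there are finitely many [j]. *)
Lemma le_finite e f : exists s : seq E, forall z, le e z -> le z f -> z \in s.
Proof.
have /choice[s Hs] j : exists s : seq E, forall q, le e (em j q) ->
  le (em j q) f -> em j q \in s.
  have [a [_ [ae _]]] := between e j; have [_ [b [_ fb]]] := between f j.
  have [s Hs] := interval_finite (tree j) a b; exists (map (em j) s) => q eq qf.
  by apply/map_f/Hs; apply/em_le; [exact: le_trans ae eq|exact: le_trans qf fb].
exists (flatten [seq s j | j <- enum 'I_n]) => z ez zf.
have [j [q zq]] := em_surj z; apply/flattenP; exists (s j).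
  by apply: map_f; rewrite mem_enum.
by rewrite zq; apply: Hs; rewrite -zq.
Qed.

Lemma le_interval_ind (P : E -> E -> Prop) :
    (forall e f, le e f ->
      (forall e' f', le e e' -> le e' f' -> le f' f -> e' <> e \/ f' <> f ->
        P e' f') ->
      P e f) ->
  forall e f, le e f -> P e f.
Proof.
move=> IH e f; have [s Hs] := le_finite e f.
have [m] := ubnP (size s); elim: m => // m IHm in e f s Hs *.
rewrite ltnS => sm ef; apply: IH => // e' f' ee' ef' ff' ne.
have [x xs nx] : exists2 x, x \in s & forall z, le e' z -> le z f' -> z <> x.
  case: ne => ne; [exists e|exists f].
  - exact: Hs (le_refl e) ef.
  - by move=> z e'z zf' ze; apply: ne; apply: le_anti ee'; rewrite -ze.
  - exact: Hs ef (le_refl f).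
  - by move=> z e'z zf' ze; apply: ne; apply: le_anti ff' _; rewrite -ze.
apply: (IHm e' f' [seq z <- s | z != x]) => //.
- move=> z e'z zf'; rewrite mem_filter; apply/andP; split.
    by apply/eqP; exact: nx.
  by apply: Hs; [exact: le_trans e'z|exact: le_trans zf' ff'].
- apply: leq_trans sm; rewrite size_filter -(count_predC (pred1 x) s).
  by rewrite -[X in X < _]add0n ltn_add2r -has_count has_pred1.
Qed.

(* The elements of the pocset that contain the initial vertex of e. *)
Definition star_set e : set E := [set z | le e z \/ (le (star e) z /\ z <> star e)].

Lemma star_set_self e : star_set e e. Proof. by left; exact: le_refl. Qed.

Lemma star_set_star e z : star_set e (star z) <-> ~ star_set e z.
Proof.
split=> [h1 h2|h].
  case: h1 h2 => [ez|[ez nE]] [ez'|[ez' nE']].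
  - exact: le_both ez' ez.
  - by apply: nE'; apply: le_anti => //; apply/le_starr.
  - by apply: nE; congr star; apply: le_anti => //; apply/le_starE.
  - exact: le_both ez' ez.
have [ez|ze|ez|ze] := le_nested e z.
- by case: h; left.
- right; split; first exact: le_star.
  by move/(can_inj starK) => ze'; apply: h; rewrite ze'; exact: star_set_self.
- by left.
- have [ze'|nE] := pselect (z = star e); first by left; rewrite ze' starK.
  by case: h; right; split=> //; apply/le_starl.
Qed.

Lemma star_set_star_self e : ~ star_set (star e) e.
Proof. by apply/star_set_star; exact: star_set_self. Qed.

Lemma star_set_crossing e z : star_set e z -> ~ star_set (star e) z -> z = e.
Proof.
move=> ez nez; apply: contrapT => nE; apply: nez; rewrite /star_set /= starK.
by case: ez => [ez|[ez _]]; [right|left].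
Qed.

Lemma star_set_inj e f :
  star_set e = star_set f -> star_set (star e) = star_set (star f) -> e = f.
Proof.
move=> E1 E2; apply: star_set_crossing; first by rewrite -E1; exact: star_set_self.
by rewrite -E2; exact: star_set_star_self.
Qed.

Lemma star_set_sub e f : star_set e `<=` star_set f -> star_set e = star_set f.
Proof.
move=> ef; apply/seteqP; split=> // z fz; apply: contrapT => /star_set_star /ef.
by move/star_set_star; apply.
Qed.

(** The end of an edge is the beginning of the next one. Finite intervals can thus be walked through
    edge by edge, whence connectedness. *)
Lemma star_set_cover e z : le e z -> e <> z ->
    (forall w, le e w -> le w z -> w = e \/ w = z) ->
  star_set (star e) = star_set z.
Proof.
move=> ez nez cov; apply/esym/star_set_sub => w; rewrite /star_set /= starK.
have contra w' : le w' e -> le (star z) w' -> False.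
  move=> we zw; apply: (@le_both (star z) z); last exact: le_refl.
  by apply: le_trans zw _; apply: le_trans we ez.
case=> [zw|[zw nE]].
  right; split; first exact: le_trans ez zw.
  by move=> we; apply: nez; apply: le_anti => //; rewrite -we.
have [ew|we|ew|we] := le_nested e w.
- have [we|nwe] := pselect (w = e); last by right.
  by exfalso; apply: (contra e) => //; rewrite -we.
- by exfalso; exact: contra we zw.
- have wz : le (star w) z by apply/le_starl.
  case: (cov _ ew wz) => Ew; first by left; rewrite -Ew starK.
  by case: nE; rewrite -Ew starK.
- by left; apply/le_starl.
Qed.

Lemma star_set_ac g e z : star_set (ac g e) z <-> star_set e (ac g^-1 z).
Proof.
rewrite /star_set /= star_ac.
have H a : le (ac g a) z <-> le a (ac g^-1 z) by rewrite -{1}[z](acVK g) le_acE.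
rewrite !H; suff -> : z <> ac g (star e) <-> ac g^-1 z <> star e by [].
by split=> nE E'; apply: nE; rewrite ?E' ?acK // -E' acVK.
Qed.

Definition pocset_vertex : eqType := {C : set E | `[< exists e, C = star_set e >]}.

Lemma pv_subproof e : `[< exists f, star_set e = star_set f >].
Proof. by apply/asboolP; exists e. Qed.

Definition pv e : pocset_vertex := Sub (star_set e) (pv_subproof e).

Lemma pvP (C : pocset_vertex) : exists e, C = pv e.
Proof. by case: C => C H; have /asboolP[e Ce] := H; exists e; apply: val_inj. Qed.

Definition pocset_adj : rel pocset_vertex := fun C D =>
  `[< exists e, C = pv e /\ D = pv (star e) >].

Lemma pocset_act_subproof g (C : pocset_vertex) :
  `[< exists e, [set z | val C (ac g^-1 z)] = star_set e >].
Proof.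
have [e ->] := pvP C; apply/asboolP; exists (ac g e).
by apply/seteqP; split=> z; rewrite star_set_ac.
Qed.

Definition pocset_act g C : pocset_vertex :=
  Sub [set z | val C (ac g^-1 z)] (pocset_act_subproof g C).

Lemma pocset_act_pv g e : pocset_act g (pv e) = pv (ac g e).
Proof. by apply: val_inj; apply/seteqP; split=> z /star_set_ac. Qed.

Lemma pocset_adjC : symmetric pocset_adj.
Proof.
by move=> C D; apply/asboolP/asboolP => -[e [-> ->]]; exists (star e);
  rewrite starK.
Qed.

Lemma pocset_act1 C : pocset_act 1 C = C.
Proof. by have [e ->] := pvP C; rewrite pocset_act_pv ac1. Qed.

Lemma pocset_actM g h C : pocset_act (g * h) C = pocset_act g (pocset_act h C).
Proof. by have [e ->] := pvP C; rewrite !pocset_act_pv acM. Qed.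

Lemma pocset_adj_act g C D :
  pocset_adj (pocset_act g C) (pocset_act g D) = pocset_adj C D.
Proof.
have imp h C' D' : pocset_adj C' D' ->
    pocset_adj (pocset_act h C') (pocset_act h D').
  move=> /asboolP[e [-> ->]]; apply/asboolP; exists (ac h e).
  by rewrite !pocset_act_pv star_ac.
apply/idP/idP => [/(imp g^-1)|]; last exact: imp.
by rewrite -!pocset_actM mulVg !pocset_act1.
Qed.

Definition pocset_graph : ggraph G :=
  GGraph pocset_adjC pocset_act1 pocset_actM pocset_adj_act.

Lemma adj_pv e : pocset_adj (pv e) (pv (star e)).
Proof. by apply/asboolP; exists e. Qed.

Lemma pocset_adj_crossing C D e : pocset_adj C D -> val C e -> ~ val D e ->
  C = pv e /\ D = pv (star e).
Proof.
by move=> /asboolP[f [-> ->]] fe nfe; rewrite (star_set_crossing fe nfe).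
Qed.

Lemma pocset_path_crossing C e p : path pocset_adj C p ->
    ~ val C e -> val (last C p) e ->
  exists p1 p2, C :: p = p1 ++ pv (star e) :: pv e :: p2.
Proof.
move=> Cp nCe le_.
have [|p1 [y [z [p2 [-> ny nz yz]]]]] :=
  @path_crossing _ _ (fun C => ~ val C e) _ _ nCe _ Cp; first by move/(_ le_).
have [|||-> ->] := @pocset_adj_crossing z y e; first by rewrite pocset_adjC.
- exact: contrapT nz.
- exact: ny.
by exists p1, p2.
Qed.

Lemma pocset_connected C D : joined pocset_adj C D.
Proof.
have [e ->] := pvP C; have [f ->] := pvP D => {C D}.
have H e' f' : le e' f' -> joined pocset_adj (pv e') (pv f').
  move: e' f'; apply: le_interval_ind => a b ab IH.
  have [->|nab] := pselect (a = b); first exact: joinedxx.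
  have [[w [aw wb wa wb']]|cov] :=
      pselect (exists w, [/\ le a w, le w b, w <> a & w <> b]).
    by apply: (joined_trans (y := pv w)); apply: IH => //; [right|left].
  apply: (joined_trans (y := pv (star a))); first exact/joined1/adj_pv.
  suff -> : pv (star a) = pv b by exact: joinedxx.
  apply: val_inj; apply: star_set_cover => // w aw wb.
  have [|wa] := pselect (w = a); first by left.
  by right; apply: contrapT => wb'; apply: cov; exists w.
have Hs e' : joined pocset_adj (pv (star e')) (pv e').
  by apply: joined1; rewrite pocset_adjC; exact: adj_pv.
have Hs' e' : joined pocset_adj (pv e') (pv (star e')) by exact/joined1/adj_pv.
have [ef|fe|ef|fe] := le_nested e f.
- exact: H.
- exact: joined_sym pocset_adjC _ _ (H _ _ fe).
- exact: joined_trans (H _ _ ef) (Hs _).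
- by apply: joined_trans (Hs' _) _; apply: H; apply/le_starl.
Qed.

Lemma pocset_tree : is_tree pocset_adj.
Proof.
split.
- by case: inhE => e; constructor; exact: pv e.
- move=> C; apply/asboolP => -[e [-> /(congr1 val) /= E']].
  by apply: (@star_set_star_self e); rewrite -E'; exact: star_set_self.
- exact: pocset_connected.
(* The rest of the cycle leads from [x1] back to [x0], across [e], which only the step from [x1] to
   [x0] can cross. As no vertex is repeated, this is the first step after [x1], and the cycle has
   length two. *)
- case=> [|x0 [|x1 r]] //= /and3P[x0N x1r Ur] /andP[/asboolP[e [x0E x1E]] p1].
  have [||q1 [q2 Eq]] := @pocset_path_crossing x1 e (rcons r x0) p1.
  + by rewrite x1E; exact: star_set_star_self.
  + by rewrite last_rcons x0E; exact: star_set_self.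
  rewrite -x1E -x0E in Eq; case: q1 Eq => [|y q1] /= [].
    case: r x0N {x1r Ur p1} => //= y r x0N [yx0 _].
    by rewrite -yx0 !in_cons eqxx orbT in x0N.
  move=> _ Er; have : x1 \in rcons r x0 by rewrite Er mem_cat in_cons eqxx orbT.
  rewrite mem_rcons in_cons (negPf x1r) orbF => /eqP x10.
  by rewrite x10 in_cons eqxx in x0N.
Qed.

Lemma pv_inj e f : pv e = pv f -> pv (star e) = pv (star f) -> e = f.
Proof. by move=> /(congr1 val) E1 /(congr1 val) E2; exact: star_set_inj. Qed.

Lemma pocset_inverts_no_edge : inverts_no_edge pocset_graph.
Proof.
move=> g C D /asboolP[e [-> ->]] []; rewrite /= !pocset_act_pv => E1 E2.
have E' : ac g e = star e by apply: pv_inj; rewrite ?star_ac // starK.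
have [j [p pE]] := em_surj e; rewrite pE -em_ac -em_rev in E'.
exact: (@eact_neq_rev _ _ (splits j) g p (em_inj E')).
Qed.

Definition orbit_of j : set (pocset_graph * pocset_graph) :=
  [set P | exists p, P = (pv (em j p), pv (star (em j p)))].

Lemma orbit_of_edge j p :
  edge_orbit (pv (em j p) : pocset_graph) (pv (star (em j p))) = orbit_of j.
Proof.
apply/seteqP; split=> [_ [g [->|->]]|_ [q ->]] /=.
- by exists (eact g p); rewrite em_ac !pocset_act_pv star_ac.
- by exists (eact g (rev p)); rewrite em_ac !pocset_act_pv em_rev -star_ac starK.
have [g [->|->]] := dedge_orbit (splits j) p q; exists g; [left|right] => /=.
  by rewrite !pocset_act_pv em_ac star_ac.
by rewrite !pocset_act_pv em_ac em_rev star_ac starK.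
Qed.

Lemma orbit_of_bij : set_bij setT (@edge_orbits G pocset_graph) orbit_of.
Proof.
split.
- move=> j _; case: (dedge_inhabited (splits j)) => p.
  by exists (pv (em j p)), (pv (star (em j p))); rewrite orbit_of_edge;
    split=> //; exact: adj_pv.
- move=> j k _ _ E'; case: (dedge_inhabited (splits j)) => p.
  have : orbit_of j (pv (em j p), pv (star (em j p))) by exists p.
  rewrite E' => -[q Eq]; apply: (@em_index j k p q).
  by apply: pv_inj; [exact: (congr1 fst Eq)|exact: (congr1 snd Eq)].
- move=> _ [C [D [/asboolP[e [-> ->]] ->]]]; have [j [p ->]] := em_surj e.
  by exists j => //; rewrite orbit_of_edge.
Qed.

(** * The collapses of the tree are the given trees *)

Section Collapse.
Variable j : 'I_n.
Implicit Types (C D W : pocset_graph) (p q : dedge (tau j)).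

Lemma keptE C D : kept (orbit_of j) C D <-> orbit_of j (C, D).
Proof.
split=> [/andP[_ /asboolP <-]|[p [-> ->]]]; first by exists 1; left; rewrite !act1.
by apply/andP; split; [exact: adj_pv|apply/asboolP; exact: orbit_of_edge].
Qed.

Definition agree C D := forall q, val C (em j q) <-> val D (em j q).

Lemma lost_agree C D : joined (lost (orbit_of j)) C D -> agree C D.
Proof.
move: D; apply: joined_ind => // D D' CD /andP[DD' /negP nk] q; rewrite CD.
split=> h; apply: contrapT => nh; apply: nk; apply/keptE.
  by have [-> ->] := pocset_adj_crossing DD' h nh; exists q.
have [|-> ->] := @pocset_adj_crossing D' D (em j q) _ h nh.
  by rewrite pocset_adjC.
by exists (rev q); rewrite em_rev starK.
Qed.

(** If a simple path from [C] to [D] used an edge of orbit [j], it would cross this edge twice,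
    since [C] and [D] lie on the same side of it; a vertex would then be repeated. *)
Lemma agree_lost C D : agree C D -> joined (lost (orbit_of j)) C D.
Proof.
move=> CD; have [p Cp DE] := pocset_connected C D.
case: (shortenP Cp) DE => {Cp}p Cp Up _ DE; exists p => //.
apply/negP => -/negP nl; have [p1 [y [z [p2 [Ep yz]]]]] := path_step Cp nl.
rewrite /lost /= yz /= negbK => /keptE[q [yE zE]].
set e := em j q in yE zE.
have nze : ~ val z e by rewrite zE; exact: star_set_star_self.
have ye : val y e by rewrite yE; exact: star_set_self.
have Cat : path pocset_adj y (z :: p2) /\ (p1 = [::] /\ C = y \/
    exists2 p1', p1 = C :: p1' & path pocset_adj C (rcons p1' y)).
  case: p1 Ep Cp => [|c p1] [-> ->]; first by move=> yp; split; [exact: yp|left].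
  rewrite cat_path /= => /and3P[Cp1 ly zp2]; split; first exact: zp2.
  by right; exists p1; rewrite ?rcons_path ?Cp1.
move: Up; rewrite Ep cat_uniq => /and3P[_ np1 /andP[ynz _]].
have Ce : val C e.
  case: Cat => _ [[_ ->] //|[p1' p1E Cp1]]; apply: contrapT => nCe.
  have [|q1 [q2]] := pocset_path_crossing Cp1 nCe; first by rewrite last_rcons.
  rewrite -zE -rcons_cons -p1E => Eq.
  have : z \in rcons p1 y by rewrite Eq mem_cat in_cons eqxx orbT.
  rewrite mem_rcons in_cons => /orP[/eqP zy|zp1]; first by rewrite zy in nze.
  by move: np1; rewrite /= zp1 orbT.
case: Cat => /andP[yz' zp2] _.
have [|q1 [q2 Eq]] := @pocset_path_crossing z e p2 zp2 nze.
  have -> : last z p2 = D by rewrite DE -[RHS]/(last C (C :: p)) Ep last_cat.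
  exact/CD.
by move: ynz; rewrite Eq -yE mem_cat !in_cons eqxx !orbT.
Qed.

Lemma star_set_em p q : star_set (em j p) (em j q) <-> side q (src p).
Proof.
rewrite (src_sideP (tree j)) /star_set /= -em_rev !em_le.
suff -> : em j q <> em j (rev p) <-> q <> rev p by [].
by split=> nE E'; apply: nE; [rewrite E'|exact: em_inj].
Qed.

Lemma exists_minimal_above e : exists m : dedge (tau j),
  le e (em j m) /\ forall q, le e (em j q) -> ele q m -> q = m.
Proof.
have [_ [b [_ eb]]] := between e j.
have H e' f' : le e' f' -> forall p, f' = em j p -> exists m : dedge (tau j),
    le e' (em j m) /\ forall q, le e' (em j q) -> ele q m -> q = m.
  move: e' f'; apply: le_interval_ind => a z az IH p zp.
  have [[q [aq qp nqp]]|nq] := pselect (exists q, [/\ le a (em j q), ele q p &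
    q <> p]).
    apply: (IH a (em j q)) => //; first by rewrite zp; apply/em_le.
    by right=> qz; apply: nqp; apply: em_inj; rewrite qz.
  exists p; split=> [|q aq qp]; first by rewrite -zp.
  by apply: contrapT => nqp; apply: nq; exists q.
exact: H eb b erefl.
Qed.

(** The vertex is the source of a minimal edge [m] of tree [j] above [e]. Both families of
    half-spaces contain exactly one of [q] and [rev q], so that one inclusion suffices. *)
Lemma star_set_vertex e : exists x : tau j, forall q,
  star_set e (em j q) <-> side q x.
Proof.
have [m [em_ min_m]] := exists_minimal_above e; exists (src m) => q.
rewrite -star_set_em.
have sub p : star_set e (em j p) -> star_set (em j m) (em j p).
  move=> ep; have nep : ~ star_set e (star (em j p)) by move/star_set_star.
  have em' : star_set e (em j m) by left.
  have [mp|pm|mp|pm] := nested (tree j) m p.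
  - by left; apply/em_le.
  - case: ep => [ep|[ep _]]; first by rewrite (min_m p ep pm); exact: star_set_self.
    by exfalso; apply: (le_both_left em_); apply: le_trans ep _; apply/em_le.
  - case: nep; left; apply: le_trans em_ _; rewrite -em_rev; exact/em_le.
  - right; split; first by rewrite -em_rev; apply/em_le/(ele_revl (tree j)).
    by move=> pm'; apply: nep; rewrite pm' starK.
split; first exact: sub.
move=> mq; apply: contrapT => /star_set_star; rewrite -em_rev => /sub.
by rewrite em_rev => /star_set_star.
Qed.

Lemma collapse_gg_iso : gg_iso (collapse (orbit_of j)) (tau j).
Proof.
pose R (C : collapse (orbit_of j)) (x : tau j) :=
  exists2 W, val C W & forall q, val W (em j q) <-> side q x.
have valP (C : collapse (orbit_of j)) W W' : val C W -> val C W' <-> agree W W'.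
  case: C => C /= /[dup] /asboolP[U ->] _ UW; split.
    move=> UW' q; rewrite -(lost_agree UW q); exact: lost_agree.
  by move=> /agree_lost WW'; exact: joined_trans WW'.
have inC (C : collapse (orbit_of j)) : exists W, val C W.
  by case: C => C /= /[dup] /asboolP[U ->] _; exists U; exact: joinedxx.
have ofW W : exists C : collapse (orbit_of j), val C W.
  have sP : `[< exists U, lost_class (orbit_of j) W = lost_class (orbit_of j) U >].
    by apply/asboolP; exists W.
  exists (Sub (lost_class (orbit_of j) W) sP : collapse_vertex (orbit_of j)).
  exact: joinedxx.
have Rpv (C : collapse (orbit_of j)) p x : R C x -> src p = x ->
  val C (pv (em j p)).
  move=> [W CW Wx] px; apply/(valP _ _ _ CW) => q.
  by rewrite Wx -px; split=> /star_set_em.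
have Rfun (C : collapse (orbit_of j)) x x' : R C x -> R C x' -> x = x'.
  move=> [W CW Wx] [W' CW' Wx']; apply: (sides_separate (tree j)) => q.
  by rewrite -Wx -Wx'; exact: (valP _ _ _ CW).1.
apply: (rel_gg_iso (R := R)) => //.
- move=> C; have [W CW] := inC C; have [e We] := pvP W.
  have [x ex] := star_set_vertex e; exists x, W; [exact: CW|by move=> q;
    rewrite We; exact: ex].
- move=> x; have [p <-] := vertex_incident (splits j) x.
  have [C Cp] := ofW (pv (em j p)); exists C, (pv (em j p));
    [exact: Cp|move=> q; exact: star_set_em].
- move=> C D x [W CW Wx] [W' DW' W'x]; apply: val_inj; apply/seteqP.
  have WW' : agree W W' by move=> q; rewrite Wx W'x.
  have CW' : val C W' by apply/(valP _ _ _ CW).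
  by split=> U; rewrite (valP _ _ _ CW') (valP _ _ _ DW').
- move=> C x D y Cx Dy; split=> [/asboolP[U [U' [CU DU']]]|xy].
    move=> /keptE[q [UE U'E]].
    have -> : x = src q.
      by apply: Rfun Cx _; exists U => // p; rewrite UE; exact: star_set_em.
    have -> : y = src (rev q); last exact: dedgeP.
    by apply: Rfun Dy _; exists U' => // p; rewrite U'E -em_rev; exact: star_set_em.
  apply/asboolP; exists (pv (em j (mk_dedge xy))), (pv (em j (rev (mk_dedge xy)))).
  split; [exact: Rpv Cx _|exact: Rpv Dy _|apply/keptE].
  by exists (mk_dedge xy); rewrite em_rev.
- move=> g C x [W CW Wx]; exists (act g W); first by exists W.
  by move=> q; rewrite -{2}(eactVK g q) side_act -Wx em_ac.
Qed.

End Collapse.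

Theorem pocset_compatible : compatible tau.
Proof.
exists pocset_graph; split; first by split;
  [exact: pocset_tree|exact: pocset_inverts_no_edge].
by exists orbit_of; split; [exact: orbit_of_bij|exact: collapse_gg_iso].
Qed.

End Pocset.

(** * The empty family, whose compatibility tree is a point *)

Section EmptyFamily.
Context {G : groupType}.

Definition point_graph : ggraph G.
Proof.
by refine (@GGraph G unit (fun _ _ => false) (fun _ x => x) _ _ _ _).
Defined.

Lemma empty_compatible (sigma : 'I_0 -> ggraph G) : compatible sigma.
Proof.
exists point_graph; split.
  split=> [|g a b //]; split=> [|x|[] []|[|x [|y [|z c]]]] //.
  exact: joinedxx.
exists (fun i : 'I_0 => match i with Ordinal _ H => False_rect _ (notF H) end).
split=> [|[]//]; split=> [[]|[]|O [a [b []]]] //.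
Qed.

End EmptyFamily.

(** * Nesting and sandwiching for all edges *)

Section Nesting.
Context {G : groupType}.
Local Open Scope group_scope.
Local Open Scope classical_set_scope.
Implicit Types A B C : set G.

Definition almost_nested A B :=
  [\/ asub A B, asub A (~` B), asub (~` A) B | asub (~` A) (~` B)].

Lemma almost_nestedCl A B : almost_nested A B -> almost_nested (~` A) B.
Proof.
by rewrite /almost_nested setCK => -[]; [exact: Or43|exact: Or44|exact:
  Or41|exact: Or42].
Qed.

Lemma almost_nestedCr A B : almost_nested A B -> almost_nested A (~` B).
Proof.
by rewrite /almost_nested setCK => -[]; [exact: Or42|exact: Or41|exact:
  Or44|exact: Or43].
Qed.

Lemma almost_nested_translate g A B :
  almost_nested A B -> almost_nested (translate g A) (translate g B).
Proof.
rewrite /almost_nested -!translateC.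
by case=> /(asub_translate g); [exact: Or41|exact: Or42|exact: Or43|exact: Or44].
Qed.

Lemma almost_nested_aeq A B A' B' :
    almost_inv A -> almost_inv B -> almost_inv A' -> almost_inv B' ->
  aeq A A' -> aeq B B' -> almost_nested A B -> almost_nested A' B'.
Proof.
move=> aA aB aA' aB' AA' BB'.
have H P Q P' Q' : almost_inv P -> almost_inv Q -> almost_inv P' -> almost_inv Q' ->
    aeq P P' -> aeq Q Q' -> asub P Q -> asub P' Q'.
  move=> aP aQ aP' aQ' [_ P'P] [QQ' _] PQ; apply: (asub_trans aP' aP aQ' P'P).
  exact: asub_trans QQ'.
have cA := almost_invC aA; have cB := almost_invC aB.
have cA' := almost_invC aA'; have cB' := almost_invC aB'.
have AA'C := aeqC aA aA' AA'; have BB'C := aeqC aB aB' BB'.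
case=> h.
- by apply: Or41; exact: H aA aB aA' aB' AA' BB' h.
- by apply: Or42; exact: H aA cB aA' cB' AA' BB'C h.
- by apply: Or43; exact: H cA aB cA' aB' AA'C BB' h.
- by apply: Or44; exact: H cA cB cA' cB' AA'C BB'C h.
Qed.

Lemma almost_nested_not_crosses A B : almost_nested A B -> ~ crosses A B.
Proof.
rewrite /almost_nested /asub /small stabC setCK => h [h1 h2 h3 h4].
by case: h.
Qed.

Lemma intersection_number0 (H X K Y : set G) g :
  intersection_number H X K Y = Some 0 -> ~ crosses (translate g X) Y.
Proof.
rewrite /intersection_number; case: asboolP => // fin [] card0 cr.
have : double_coset K g H \in fset_set (crossing_cosets H X K Y).
  by rewrite in_fset_set // inE; exists g.
by rewrite (cardfs0_eq card0) in_fset0.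
Qed.

(** The sets in the intersection numbers and those in the sandwiching condition may come from
    different base vertices and edges. A change of vertex yields equivalent sets, and the edges form
    one orbit up to reversal. *)
Lemma aset_almost_nested (S T : ggraph G) (v v' : S) (w w' : T) e f :
    is_splitting S -> is_splitting T -> exact_stab v -> exact_stab w ->
    exact_stab v' -> exact_stab w' ->
    (forall g, ~ crosses (translate g (aset v e)) (aset w f)) ->
  forall p q, almost_nested (aset v' p) (aset w' q).
Proof.
move=> spS spT exv exw exv' exw' nc p q.
have aiS x z : exact_stab x -> almost_inv (@aset _ S x z) by exact: aset_almost_inv.
have aiT x z : exact_stab x -> almost_inv (@aset _ T x z) by exact: aset_almost_inv.
apply: (almost_nested_aeq (A := aset v p) (B := aset w q));
  try by [exact: aiS|exact: aiT].
- by split; exact: aset_change.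
- by split; exact: aset_change.
have base g h : almost_nested (translate g (aset v e)) (translate h (aset w f)).
  have /not_crosses/(almost_nested_translate h) := nc (h^-1 * g).
  by rewrite -translateM mulVKg.
have [g [->|->]] := dedge_orbit spS e p; have [h [->|->]] := dedge_orbit spT f q;
  rewrite !aset_eact ?aset_rev // ?translateC.
- exact/almost_nestedCr/base.
- exact/almost_nestedCl/base.
- exact/almost_nestedCl/almost_nestedCr/base.
Qed.

(** Nesting excludes the crossing alternative of [sandwiched]. Translation carries the bounds to the
    orbit of [e], and reversal exchanges lower and upper bounds. *)
Lemma sandwiched_between (S T : ggraph G) (v : S) (w : T) e f :
    is_splitting S -> is_splitting T ->
    exact_stab v -> exact_stab w -> almost_nested (aset v e) (aset w f) ->
    sandwiched (aset v e) (aset w f) ->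
  forall p, exists a b,
    asub (aset w a) (aset v p) /\ asub (aset v p) (aset w b).
Proof.
move=> spS spT exv exw nest [|cr]; last first.
  case: (almost_nested_not_crosses nest); apply: cr.
  by exists 1; left; rewrite translate1.
case=> _ [_ [/(Sigma_aset spT)[a ->] /(Sigma_aset spT)[b ->] /ai_le_asub ae
  /ai_le_asub eb]] p.
have aiS z : almost_inv (aset v z) by exact: aset_almost_inv.
have aiT z : almost_inv (aset w z) by exact: aset_almost_inv.
have [g [->|->]] := dedge_orbit spS e p.
  by exists (eact g a), (eact g b); rewrite !aset_eact; split;
    exact: asub_translate.
exists (eact g (rev b)), (eact g (rev a)); rewrite !aset_eact !aset_rev //.
by split; apply/asub_translate/asubC.
Qed.

End Nesting.

(** * The pocset of the edges of all the trees *)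

Section Assembly.
Context {G : groupType} (n : nat) (sigma : 'I_n -> ggraph G).
Local Open Scope group_scope.
Local Open Scope classical_set_scope.
Variables (r : 'I_n -> 'I_n) (v : forall i, sigma i) (e0 : forall i,
  dedge (sigma i)).
Hypothesis splits : forall i, is_splitting (sigma i).
Hypothesis exv : forall i, exact_stab (v i).
Hypothesis not_aeq : forall i k p q, r i <> r k ->
  ~ aeq (aset (v (r i)) p) (aset (v (r k)) q).
Hypothesis almost_nest : forall i k p q, r i <> r k ->
  almost_nested (aset (v (r i)) p) (aset (v (r k)) q).
Hypothesis sandwich : forall i k p, r i <> r k -> exists a b,
  asub (aset (v (r k)) a) (aset (v (r i)) p) /\
  asub (aset (v (r i)) p) (aset (v (r k)) b).

Let tree i := splitting_tree (splits i).

Notation forest := {i : 'I_n & dedge (sigma i)}.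
Implicit Types x y z : forest.

Definition forest_set x : set G := aset (v (tag x)) (tagged x).
Definition frev x : forest := existT _ (tag x) (rev (tagged x)).
Definition fact g x : forest := existT _ (tag x) (eact g (tagged x)).
Definition fle x y : Prop :=
  exists Exy : tag x = tag y,
    ele (eq_rect _ (fun i => dedge (sigma i)) (tagged x) _ Exy) (tagged y).
Definition fpos x : Prop := exists g, tagged x = eact g (e0 (tag x)).

Lemma fleE i (p q : dedge (sigma i)) :
  fle (existT _ i p) (existT _ i q) <-> ele p q.
Proof.
split=> [[Exy]|pq]; last by exists erefl.
by rewrite /= in Exy *; rewrite (eq_axiomK Exy).
Qed.

Lemma forest_ind (P : forest -> forest -> Prop) :
  (forall i p q, P (existT _ i p) (existT _ i q)) ->
  forall x y, tag x = tag y -> P x y.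
Proof. by move=> H [i p] [j q] /= E; subst j. Qed.

Lemma fle_tag x y : fle x y -> tag x = tag y. Proof. by case. Qed.

Lemma fle_refl x : fle x x.
Proof. by case: x => i p; apply/fleE; exact: ele_refl. Qed.

Lemma fle_trans x y z : fle x y -> fle y z -> fle x z.
Proof.
move=> xy yz; have Exy := fle_tag xy; have Eyz := fle_tag yz.
case: x y z Exy Eyz xy yz => i p [j q] [k s] /= E E'.
by subst j k => /fleE pq /fleE qs; apply/fleE; exact: ele_trans qs.
Qed.

Lemma fle_anti x y : fle x y -> fle y x -> x = y.
Proof.
move=> xy; have Exy := fle_tag xy; move: x y Exy xy; apply: forest_ind => i p q.
by move=> /fleE pq /fleE qp; rewrite (ele_anti (tree i) pq qp).
Qed.

Lemma frevK : involutive frev.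
Proof. by case=> i p; rewrite /frev /= revK. Qed.

Lemma fle_rev x y : fle x y -> fle (frev y) (frev x).
Proof.
move=> xy; have Exy := fle_tag xy; move: x y Exy xy; apply: forest_ind => i p q.
by move=> /fleE pq; apply/fleE/(ele_rev (tree i)).
Qed.

Lemma fle_act g x y : fle x y -> fle (fact g x) (fact g y).
Proof.
move=> xy; have Exy := fle_tag xy; move: x y Exy xy; apply: forest_ind => i p q.
by move=> /fleE pq; apply/fleE/ele_act.
Qed.

Lemma fle_nested x y : tag x = tag y ->
  [\/ fle x y, fle y x, fle x (frev y) | fle (frev y) x].
Proof.
move: x y; apply: forest_ind => i p q.
by case: (nested (tree i) p q) => /fleE;
  [exact: Or41|exact: Or42|exact: Or43|exact: Or44].
Qed.

Lemma forest_set_rev x : forest_set (frev x) = ~` forest_set x.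
Proof. exact: aset_rev. Qed.

Lemma forest_set_act g x : forest_set (fact g x) = translate g (forest_set x).
Proof. exact: aset_eact. Qed.

Lemma forest_set_almost_inv x : almost_inv (forest_set x).
Proof. exact: aset_almost_inv. Qed.
Let ai := forest_set_almost_inv.

Lemma fle_asub x y : fle x y -> asub (forest_set x) (forest_set y).
Proof.
move=> xy; have Exy := fle_tag xy; move: x y Exy xy;
  apply: forest_ind => i p q /fleE pq.
exact/sub_asub/aset_sub.
Qed.

(** There is one orbit of edges and no inversion, so the orbit of [e0] contains exactly one
    direction of each edge. *)
Lemma fpos_rev x : fpos (frev x) <-> ~ fpos x.
Proof.
case: x => i p; rewrite /fpos /=; split=> [[g E] [h E']|np].
  apply: (@eact_neq_rev _ _ (splits i) (g * h^-1) p).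
  by rewrite eactM {1}E' eactK -E.
have [g [E|E]] := dedge_orbit (splits i) (e0 i) p; first by case: np; exists g.
by exists g; rewrite E -rev_eact revK.
Qed.

Lemma fpos_act g x : fpos (fact g x) <-> fpos x.
Proof.
split=> -[h E]; last by exists (g * h); rewrite /= E eactM.
by exists (g^-1 * h); rewrite eactM -E /= eactK.
Qed.

(* Isomorphic splittings share the tree of one of them, and the edges over the
   same edge of that tree are told apart by their indices: in increasing order
   along the orientation given by the orbit of [e0], so that the order is
   G-invariant and reversed by [rev]. *)
Notation edges := {i : 'I_n & dedge (sigma (r i))}.
Implicit Types e f h : edges.

Definition under e : forest := existT _ (r (tag e)) (tagged e).
Definition erev e : edges := existT _ (tag e) (rev (tagged e)).
Definition eac g e : edges := existT _ (tag e) (eact g (tagged e)).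

Definition tie e f : Prop :=
  if `[< fpos (under e) >] then tag e <= tag f else tag f <= tag e.

Definition edge_le e f : Prop :=
  if r (tag e) == r (tag f) then
    fle (under e) (under f) /\ (under e = under f -> tie e f)
  else asub (forest_set (under e)) (forest_set (under f)).

Lemma edge_le_same e f : r (tag e) = r (tag f) ->
  edge_le e f <-> fle (under e) (under f) /\ (under e = under f -> tie e f).
Proof. by rewrite /edge_le => ->; rewrite eqxx. Qed.

Lemma edge_le_diff e f : r (tag e) <> r (tag f) ->
  edge_le e f <-> asub (forest_set (under e)) (forest_set (under f)).
Proof. by rewrite /edge_le => /eqP/negPf ->. Qed.

Lemma under_rev e : under (erev e) = frev (under e). Proof. by []. Qed.
Lemma under_act g e : under (eac g e) = fact g (under e). Proof. by []. Qed.

Lemma edge_le_asub e f : edge_le e f -> asub (forest_set (under e)) (forest_set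
  (under f)).
Proof. by rewrite /edge_le; case: eqP => // _ [/fle_asub]. Qed.

Lemma edge_le_refl e : edge_le e e.
Proof.
apply/edge_le_same => //; split=> [|_]; first exact: fle_refl.
by rewrite /tie; case: ifP.
Qed.

Lemma edge_le_trans e f h : edge_le e f -> edge_le f h -> edge_le e h.
Proof.
move=> ef fh; have aef := edge_le_asub ef; have afh := edge_le_asub fh.
have aeh := asub_trans (ai _) (ai _) (ai _) aef afh.
have [Eeh|neh] := pselect (r (tag e) = r (tag h)); last exact/edge_le_diff.
apply/edge_le_same => //.
have [Eef|nef] := pselect (r (tag e) = r (tag f)).
  have Efh : r (tag f) = r (tag h) by rewrite -Eef.
  move/(edge_le_same Eef): ef => [ef tef]; move/(edge_le_same Efh): fh => [fh tfh].
  split=> [|E]; first exact: fle_trans fh.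
  have E' : under e = under f by apply: fle_anti => //; rewrite E.
  move: (tef E') (tfh (etrans (esym E') E)); rewrite /tie -E'.
  by case: ifP => _ le1 le2; [exact: leq_trans le2|exact: leq_trans le1].
(* Here [e] and [h] share a tree that [f] is not in. Inclusion of [h] in [e] would make [e] and [f]
   equivalent, and the nestings that involve [frev] contradict almost inclusion of [e] in [h]. *)
have neq : ~ aeq (forest_set (under e)) (forest_set (under f)) by exact: not_aeq.
have nhe : ~ asub (forest_set (under h)) (forest_set (under e)).
  move=> he; apply: neq; split=> //; exact: asub_trans (ai _) (ai _) (ai _) afh he.
split; last by move=> E; case: nhe; rewrite E; exact: asub_refl.
case: (fle_nested (Eeh : tag (under e) = tag (under h))) => //.
- by move/fle_asub.
- by move/fle_asub; rewrite forest_set_rev => /(asub_both (ai _) aeh).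
- move/fle_rev; rewrite frevK => /fle_asub; rewrite forest_set_rev.
  by move/(asub_bothC (ai _) (ai _) aeh).
Qed.

Lemma edge_le_anti e f : edge_le e f -> edge_le f e -> e = f.
Proof.
move=> ef fe; have [E|nE] := pselect (r (tag e) = r (tag f)); last first.
  case: (not_aeq (p := tagged e) (q := tagged f) nE).
  by split; [exact: edge_le_asub ef|exact: edge_le_asub fe].
move/(edge_le_same E): ef => [ef tef]; move/(edge_le_same (esym E)): fe => [fe tfe].
have E' := fle_anti ef fe.
have Etag : tag e = tag f.
  apply/val_inj/eqP; rewrite eqn_leq; move: (tef E') (tfe (esym E')).
  by rewrite /tie E'; case: ifP => _ -> ->.
case: e f E' Etag {E ef fe tef tfe} => i p [j q] /= E' Eij; subst j.
move: E'; rewrite /under /= => E'; congr existT.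
exact: existT_inj2 E'.
Qed.

Lemma erevK : involutive erev.
Proof. by case=> i p; rewrite /erev /= revK. Qed.

Lemma edge_le_rev e f : edge_le e f -> edge_le (erev f) (erev e).
Proof.
move=> ef; have aef := edge_le_asub ef.
have [E|nE] := pselect (r (tag e) = r (tag f)); last first.
  by apply/edge_le_diff => [/esym|] //; rewrite !under_rev !forest_set_rev;
    apply: asubC.
apply/edge_le_same => //; move/(edge_le_same E): ef => [ef tef].
rewrite !under_rev; split=> [|/(can_inj frevK) E']; first exact: fle_rev.
move: (tef (esym E')); rewrite /tie under_rev E'.
have [pe|ne] := pselect (fpos (under e)).
  by rewrite (asboolT pe) asboolF // => /fpos_rev.
by rewrite (asboolF ne) asboolT //; exact/fpos_rev.
Qed.

Lemma edge_le_act g e f : edge_le e f -> edge_le (eac g e) (eac g f).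
Proof.
move=> ef; have [E|nE] := pselect (r (tag e) = r (tag f)); last first.
  apply/edge_le_diff => //; rewrite !under_act !forest_set_act.
  exact/asub_translate/edge_le_asub.
apply/edge_le_same => //; move/(edge_le_same E): ef => [ef tef].
rewrite !under_act; split=> [|E']; first exact: fle_act.
have Eu : under e = under f.
  have factK x : fact g^-1 (fact g x) = x by case: x => i p; rewrite /fact /= eactK.
  by rewrite -[under e]factK E' factK.
move: (tef Eu); rewrite /tie under_act.
by have -> : `[< fpos (fact g (under e)) >] = `[< fpos (under e) >]
  by apply: asbool_equiv_eq; exact: fpos_act.
Qed.

Lemma edge_le_total_under e f : fle (under e) (under f) ->
  edge_le e f \/ edge_le f e.
Proof.
move=> ef; have E : r (tag e) = r (tag f) := fle_tag ef.
have [Eu|nE] := pselect (under e = under f); last first.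
  by left; apply/edge_le_same.
rewrite (edge_le_same E) (edge_le_same (esym E)) /tie Eu.
have := leq_total (tag e) (tag f); have ff := fle_refl (under f).
by case: ifP => _ /orP[le|le]; [left|right|right|left].
Qed.

Lemma edge_le_nested e f :
  [\/ edge_le e f, edge_le f e, edge_le e (erev f) | edge_le (erev f) e].
Proof.
have [E|nE] := pselect (r (tag e) = r (tag f)).
  case: (fle_nested (E : tag (under e) = tag (under f)));
    rewrite -?under_rev => /edge_le_total_under [];
    by [exact: Or41|exact: Or42|exact: Or43|exact: Or44].
have nE' : r (tag f) <> r (tag e) by move/esym.
case: (almost_nest (tagged e) (tagged f) nE) => h.
- by apply: Or41; apply/edge_le_diff.
- by apply: Or43; apply/edge_le_diff; rewrite // under_rev forest_set_rev.
- apply: Or44; apply/edge_le_diff; rewrite // under_rev forest_set_rev.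
  by rewrite -[forest_set (under e)]setCK; apply: asubC => //; exact: almost_invC.
- by apply: Or42; apply/edge_le_diff => //; apply/asubC_iff.
Qed.

Lemma edge_le_both e f : edge_le e f -> edge_le e (erev f) -> False.
Proof.
move=> /edge_le_asub ef /edge_le_asub; rewrite under_rev forest_set_rev.
exact: asub_both.
Qed.

Lemma edge_le_between e j : exists a b : dedge (sigma (r j)),
  edge_le (existT _ j a) e /\ edge_le e (existT _ j b).
Proof.
have [E|nE] := pselect (r (tag e) = r j); last first.
  have [a [b [ae eb]]] := sandwich (tagged e) nE; exists a, b.
  by split; apply/edge_le_diff => //; apply/nesym.
(* The index [j] may differ from that of [e] although the tree is the same; strict bounds, from
   [no_leaf], avoid comparing indices. *)
have [a [b [ae eb]]] : exists a b : dedge (sigma (r j)),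
    (fle (existT _ (r j) a) (under e) /\ existT _ (r j) a <> under e) /\
    (fle (under e) (existT _ (r j) b) /\ under e <> existT _ (r j) b).
  rewrite /under; move: (tagged e); rewrite E => p.
  have [a [ap na]] := no_leaf (splits (r j)) p.
  have [b [bp nb]] := no_leaf (splits (r j)) (rev p).
  exists a, (rev b); rewrite !fleE; split; split=> //.
  - by move=> E'; apply: na; exact: existT_inj2 E'.
  - exact/(ele_revr (tree _)).
  - by move=> E'; apply: nb; rewrite (existT_inj2 E') revK.
by exists a, b; case: ae => ae na; case: eb => eb nb; split; apply/edge_le_same.
Qed.

Lemma assembly_compatible : 0 < n -> compatible (fun j => sigma (r j)).
Proof.
move=> n0; pose em j (p : dedge (sigma (r j))) : edges := existT _ j p.
apply: (@pocset_compatible _ _ _ edges edge_le erev eac em).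
- by move=> j; exact: splits.
- exact: edge_le_refl.
- exact: edge_le_trans.
- exact: edge_le_anti.
- exact: erevK.
- exact: edge_le_rev.
- by case=> i p; rewrite /eac /= eact1.
- by move=> g h [i p]; rewrite /eac /= eactM.
- exact: edge_le_act.
- by move=> g [i p]; rewrite /eac /erev /= rev_eact.
- exact: edge_le_nested.
- exact: edge_le_both.
- by case=> i p; exists i, p.
- by move=> j k p q E; exact: existT_inj1 E.
- move=> j p q; rewrite edge_le_same // fleE; split=> [[]//|pq]; split=> // _.
  by rewrite /tie; case: ifP.
- by [].
- by [].
- exact: edge_le_between.
- by constructor; exact: (existT _ (Ordinal n0) (e0 _)).
Qed.

End Assembly.

(** * Representatives of isomorphism classes, and the conclusion *)

Section Representatives.
Context {G : groupType} (n : nat) (sigma : 'I_n -> ggraph G).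

(** [pick] depends on the predicate only, so isomorphic splittings receive the same index. The
    default is never reached, since [j] itself qualifies. *)
Definition iso_rep (j : 'I_n) : 'I_n :=
  odflt j [pick k | `[< gg_iso (sigma k) (sigma j) >]].

Lemma iso_rep_iso j : gg_iso (sigma (iso_rep j)) (sigma j).
Proof.
rewrite /iso_rep; case: pickP => [k /asboolP //|/(_ j) /asboolP]; case.
exact: gg_iso_refl.
Qed.

Lemma iso_rep_eq j k : gg_iso (sigma j) (sigma k) -> iso_rep j = iso_rep k.
Proof.
move=> jk; rewrite /iso_rep.
have -> : [pick i | `[< gg_iso (sigma i) (sigma k) >]] =
          [pick i | `[< gg_iso (sigma i) (sigma j) >]].
  apply: eq_pick => i; apply: asbool_equiv_eq; split=> h.
    exact: gg_iso_trans h (gg_iso_sym jk).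
  exact: gg_iso_trans h jk.
by case: pickP => [//|/(_ j) /asboolP []]; exact: gg_iso_refl.
Qed.

Lemma compatible_iso (tau : 'I_n -> ggraph G) :
  (forall j, gg_iso (tau j) (sigma j)) -> compatible tau -> compatible sigma.
Proof.
move=> iso [T [gT [O [bO cO]]]]; exists T; split=> //; exists O; split=> // j.
exact: gg_iso_trans (cO j) (iso j).
Qed.

End Representatives.

Theorem theorem7p5 (G : groupType) (n : nat) (sigma : 'I_n -> ggraph G)
    (H X : 'I_n -> set G)
    (sigma_over : forall j, is_splitting_over (sigma j) (H j))
    (sandwiching : satisfies_sandwiching sigma)
    (X_arises : forall j, arises_from (sigma j) (H j) (X j))
    (i_eq0 : forall j k,
      intersection_number (H j) (X j) (H k) (X k) = Some 0) :
  compatible sigma.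
Proof.
have spl j : is_splitting (sigma j) by case: (sigma_over j).
case: n sigma H X sigma_over sandwiching X_arises i_eq0 spl => [|m] s H' X' _
  sand Xa i0 spl.
  exact: empty_compatible.
case: sand => Y [Ya _ sand].
have dataX j : {x : s j & {e | exact_stab x /\ X' j = aset x e}}.
  have := arises_from_exact (spl j) (Xa j) => /cid[x /cid[e [? _ ?]]].
  by exists x, e.
have dataY j : {v : s j & {e | exact_stab v /\ Y j = aset v e}}.
  have /cid[K /(arises_from_exact (spl j)) /cid[v /cid[e [? _ ?]]]] := Ya j.
  by exists v, e.
pose v j := tag (dataY j); pose e j := sval (tagged (dataY j)).
have exv j : exact_stab (v j) by have [] := svalP (tagged (dataY j)).
have YE j : Y j = aset (v j) (e j) by have [] := svalP (tagged (dataY j)).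
have nest j k p q : almost_nested (aset (v j) p) (aset (v k) q).
  case: (dataX j) (dataX k) => x [f [exx XE]] [y [h [exy XE']]].
  apply: (aset_almost_nested (e := f) (f := h) (spl j) (spl k) exx exy
    (exv j) (exv k)) => g.
  by rewrite -XE -XE'; exact: intersection_number0 (i0 j k).
pose r := iso_rep s.
apply: (compatible_iso (iso_rep_iso s)).
(* Equivalent sets over two representatives would make their splittings isomorphic, hence the
   representatives equal. *)
apply: (assembly_compatible e spl exv) => // [i k p q nr pq|i k p _].
  have := gg_iso_of_aeq (spl _) (exv _) (spl _) (exv _) pq.
  by move/iso_rep_eq; rewrite !(iso_rep_eq (iso_rep_iso s _)).
have sd := sand (iso_rep s i) (iso_rep s k); rewrite !YE in sd.
exact: sandwiched_between (spl _) (spl _) (exv _) (exv _) (nest _ _ _ _) sd p.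
Qed.
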